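(* Let $N\geq 1$, $0<R\leq\infty$, and let $V_{2}\geq 0$ and $W_{2}$ be smooth functions on $(0,R)$. Assume that $\left(V_{2},\,W_{2}+N\frac{V_{2}'}{r}\right)$ is an $(N+2)$-dimensional Bessel pair on $(0,R)$. If $$V_{2}''(r)-3\frac{V_{2}'(r)}{r}-(N-5)\frac{V_{2}(r)}{r^{2}}\leq 0\quad\text{on }(0,R),$$ then for all functions $u\in C_{0}^{\infty}(B_{R}\setminus\{0\})$, $$\int_{B_{R}}V_{2}(|x|)\,|\Delta u|^{2}\,dx\geq\int_{B_{R}}W_{2}(|x|)\,|\nabla u|^{2}\,dx.$$
   Context: $B_R$ is the open ball of radius $R$ centered at the origin in $\mathbb{R}^N$ (with $B_\infty=\mathbb{R}^N$). $C_0^\infty(\Omega)$ is the space of smooth functions with compact support in $\Omega$. For an integer $n\ge 1$, a pair $(V,W)$ of functions on $(0,R)$ (with $V\ge 0$ and $W$ of arbitrary sign) is an $n$-dimensional Bessel pair on $(0,R)$ if there exists a positive function $\varphi$ on $(0,R)$ such that $\left(r^{n-1}V\varphi'\right)'+r^{n-1}W\varphi=0$ on $(0,R)$. *)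

(* Defs.v *)
From HB Require Import structures.
From mathcomp Require Import all_boot all_order all_algebra.
From mathcomp Require Import all_classical all_reals all_analysis.

Set Implicit Arguments.
Unset Strict Implicit.
Unset Printing Implicit Defensive.

Import Order.TTheory GRing.Theory Num.Theory.
Import numFieldNormedType.Exports.

Local Open Scope classical_set_scope.
Local Open Scope ring_scope.

Section interval.
Context {R : realType}.
Implicit Types (Rad : \bar R) (V W : R -> R).

Definition itv0 Rad : set R := [set r | 0 < r /\ (r%:E < Rad)%E].

(* V has derivatives of all orders on (0, Rad); the values of V outside the
   interval are irrelevant, as the interval is open. *)
Definition smooth_itv0 Rad V :=
  forall n r, itv0 Rad r -> derivable (derive1n n V) r 1.

(* The regularity asked of phi is the least one for which both derivatives in
   the equation exist. Meant for n >= 1. *)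
Definition bessel_pair (n : nat) Rad V W :=
  (forall r, itv0 Rad r -> 0 <= V r) /\
  exists phi : R -> R, forall r, itv0 Rad r ->
    let flux := fun s => s ^+ n.-1 * V s * derive1 phi s in
    [/\ 0 < phi r, derivable phi r 1, derivable flux r 1
      & derive1 flux r + r ^+ n.-1 * W r * phi r = 0].

End interval.

Section euclidean.
Context {R : realType} {N : nat}.
Implicit Types (x : 'rV[R]_N) (u : 'rV[R]_N -> R).

(* The norm `|x| of the library on 'rV[R]_N is the sup norm. *)
Definition enorm x : R := Num.sqrt (\sum_i x 0 i ^+ 2).

Definition eball (Rad : \bar R) : set 'rV[R]_N :=
  [set x | ((enorm x)%:E < Rad)%E].

Definition partial (i : 'I_N) u : 'rV[R]_N -> R :=
  fun x => 'D_(delta_mx 0 i) u x.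

Definition gradient u x : 'rV[R]_N := \row_i partial i u x.

Definition laplacian u x : R := \sum_i partial i (partial i u) x.

Definition smooth u :=
  forall s : seq 'I_N, let v := foldr partial u s in
    continuous v /\ forall i x, derivable v x (delta_mx 0 i).

(* C_0^oo(D) for D open, each function being extended by 0 to R^N. *)
Definition test_function (D : set 'rV[R]_N) u :=
  [/\ smooth u, compact (closure [set x | u x != 0])
    & closure [set x | u x != 0] `<=` D].

End euclidean.

(* The n-fold product of the Lebesgue measure of the real line, on n-tuples,
   which carry the product sigma-algebra. *)
Fixpoint lebesgue_tuple (R : realType) (n : nat) :
    set (n.-tuple (measurableTypeR R)) -> \bar R :=
  match n with
  | 0%N => \d_([tuple] : 0.-tuple (measurableTypeR R))
  | m.+1 => pushforward
      (product_measure1 (@lebesgue_measure R) (@lebesgue_tuple R m))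
      (fun p => [the m.+1.-tuple (measurableTypeR R) of p.1 :: p.2])
  end.

Section lebesgue_tuple_measure.
Context (R : realType).
Local Notation T := (measurableTypeR R).
Local Notation consp n :=
  (fun p : T * n.-tuple T => [the n.+1.-tuple T of p.1 :: p.2]).

Let measurable_consp n : measurable_fun [set: T * n.-tuple T] (consp n).
Proof. by apply: measurable_cons. Qed.

Let lebesgue_tuple_sigma_finite_measure n :
  exists m : {sigma_finite_measure set (n.-tuple T) -> \bar R},
    m = @lebesgue_tuple R n :> (set (n.-tuple T) -> \bar R).
Proof.
elim: n => [|n [m mE]].
  by exists (\d_([tuple] : 0.-tuple T)).
pose P : {measure set (n.+1.-tuple T) -> \bar R} :=
  measure_function_pushforward__canonical__measure_function_Measure
    [the {measure set (T * n.-tuple T)%type -> \bar R} of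
      product_measure1 (@lebesgue_measure R) m] (@measurable_consp n).
have sP : sigma_finite setT P.
  have /sigma_finiteP[F [TF ndF Foo]] := sigma_finiteT (@lebesgue_measure R).
  have /sigma_finiteP[G [TG ndG Goo]] := sigma_finiteT m.
  pose g := fun t : n.+1.-tuple T => (thead t, [tuple of behead t]).
  have mg : measurable_fun [set: n.+1.-tuple T] g.
    apply/measurable_fun_pairP; split => /=; last exact: measurable_behead.
    exact: measurable_tnth.
  have gK (p : T * n.-tuple T) : g (consp n p) = p.
    by case: p => a b; congr pair; apply/val_inj.
  exists (fun k => g @^-1` (F k `*` G k)).
    rewrite -preimage_bigcup -(preimage_setT g); congr (_ @^-1` _).
    apply/seteqP; split => // -[x y] _.
    have : setT x by []. rewrite TF => -[i _ Fix].
    have : setT y by []. rewrite TG => -[j _ Gjy].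
    exists (maxn i j) => //; split.
    - by move: x Fix; exact/subsetPset/ndF/leq_maxl.
    - by move: y Gjy; exact/subsetPset/ndG/leq_maxr.
  move=> k; have [mF Fk] := Foo k; have [mG Gk] := Goo k; split.
    by rewrite -[X in measurable X]setTI; apply: mg => //; exact: measurableX.
  rewrite /P/= /pushforward -comp_preimage.
  rewrite (_ : g \o _ = id); last by apply/funext => p /=; exact: gK.
  by rewrite preimage_id product_measure1E// lte_mul_pinfty// ge0_fin_numE.
pose S := Measure_isSigmaFinite.Build _ _ _ P sP.
pose Q : {sigma_finite_measure set (n.+1.-tuple T) -> \bar R} :=
  HB.pack (P : set _ -> \bar R) (Measure.on P) S.
by exists Q; rewrite /Q /P /= mE.
Qed.

Variable n : nat.
Local Notation mu := (@lebesgue_tuple R n).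

Let mu0 : mu set0 = 0%E.
Proof. by have [m <-] := lebesgue_tuple_sigma_finite_measure n. Qed.

Let mu_ge0 A : (0 <= mu A)%E.
Proof. by have [m <-] := lebesgue_tuple_sigma_finite_measure n. Qed.

Let mu_sigma_additive : semi_sigma_additive mu.
Proof.
have [m <-] := lebesgue_tuple_sigma_finite_measure n.
exact: measure_semi_sigma_additive.
Qed.

HB.instance Definition _ := isMeasure.Build _ _ _ mu
  mu0 mu_ge0 mu_sigma_additive.

Let mu_sigma_finite : sigma_finite setT mu.
Proof.
have [m <-] := lebesgue_tuple_sigma_finite_measure n; exact: sigma_finiteT.
Qed.

HB.instance Definition _ := Measure_isSigmaFinite.Build _ _ _ mu
  mu_sigma_finite.

End lebesgue_tuple_measure.

Lemma lebesgue_tuple_box (R : realType) (n : nat)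
    (A : 'I_n -> set (measurableTypeR R)) :
  (forall i, measurable (A i)) ->
  lebesgue_tuple [set t | forall i, A i (tnth t i)] =
  (\prod_i lebesgue_measure (A i))%E.
Proof.
elim: n A => [|n IH] A mA.
  rewrite big_ord0 /= diracE mem_set//; by case.
rewrite big_ord_recl /= /pushforward.
pose B := [set t : n.-tuple (measurableTypeR R) |
  forall i, A (lift ord0 i) (tnth t i)].
have -> : (fun p : measurableTypeR R * n.-tuple (measurableTypeR R) =>
    [the n.+1.-tuple (measurableTypeR R) of p.1 :: p.2]) @^-1`
    [set t | forall i, A i (tnth t i)] = A ord0 `*` B.
  apply/seteqP; split => -[x t] /=.
    move=> h; split; first by have := h ord0.
    by move=> i; have := h (lift ord0 i); rewrite /= tnthS.
  by move=> [Ax Bt] i; have [j ->|->//] := unliftP ord0 i; rewrite tnthS.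
have mB : measurable B.
  rewrite (_ : B = \bigcap_(i in [set: 'I_n])
      ((@tnth _ (measurableTypeR R) ^~ i) @^-1` A (lift ord0 i))).
    apply: fin_bigcap_measurable => // i _.
    by rewrite -[X in measurable X]setTI; exact: measurable_tnth.
  by apply/seteqP; split => t /= h i; [move=> _; exact: h|exact: h].
by rewrite product_measure1E//; congr (_ * _)%E; exact: IH.
Qed.

(* The library has no measurable structure on 'rV[R]_N: the integral of f over D
   is taken on N-tuples, identified with row vectors by vec. *)
Definition integral_Rn (R : realType) (N : nat) (D : set 'rV[R]_N)
    (f : 'rV[R]_N -> R) : \bar R :=
  let vec := fun t : N.-tuple (measurableTypeR R) => \row_i (tnth t i : R) in
  (\int[@lebesgue_tuple R N]_(t in vec @^-1` D) (f (vec t))%:E)%E.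

(* Main.v *)
Require Import Defs.
From mathcomp Require Import all_boot all_order all_algebra.
From mathcomp Require Import all_classical all_reals all_analysis.
From mathcomp Require Import measurable_realfun ring lra.

Set Implicit Arguments.
Unset Strict Implicit.
Unset Printing Implicit Defensive.

Import Order.TTheory GRing.Theory Num.Theory.
Import numFieldNormedType.Exports.

Local Open Scope classical_set_scope.
Local Open Scope ring_scope.

(** Write $r = |x|$, let $\partial_r$ be the derivative along rays, let
$T^2 = |\nabla u|^2 - (\partial_r u)^2$ be the squared tangential gradient,
and let $r^2 A$ be the Hessian of the restrictions of $u$ to the spheres around
the origin, so that $r^4 |A|^2$ and $r^2 T^2$ are the squared lengths of the
spherical Hessian $\nabla_S^2 u$ and of the spherical gradient $\nabla_S u$.
Three facts are added up.

First, the Bessel pair of dimension $N+2$, used along each ray for the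
components of $\nabla u / r$, gives
$$\int V |\partial_r \nabla u - \nabla u / r|^2 \ge
  \int (W + N V'/r) |\nabla u|^2.$$
Indeed $q = V \varphi'/\varphi$ solves the Riccati equation
$q' = -(N+1) q/r - W - N V'/r - V (\varphi'/\varphi)^2$; integrate the
divergence of $(q/r) |\nabla u|^2 x$ and complete a square. Where $V$ vanishes,
$\varphi'$ may be discontinuous and so may $q'$; therefore
$V (\varphi'/\varphi)^2$ is replaced by the continuous and not larger function
$q^2/(V+\varepsilon)$, and $\varepsilon$ tends to 0 at the end ([bessel_pair_riccati],
[integral_bessel_defect]).

Second, integrations by parts with radial weights show that the difference
$$\int V |\Delta u|^2 - V |\partial_r \nabla u - \nabla u/r|^2
  + N (V'/r) |\nabla u|^2$$
is the integral of the sum of $V$ times a square, namely that of the tangential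
part of $\partial_r \nabla u + \nabla u / r$, of
$(- V'' + 3 V'/r + (N-5) V/r^2)\, T^2$, where the hypothesis on $V$ enters, and
of $V (|A|^2 - T^2/r^2)$ ([integral_rellich_defect]).

Third, the integral of $V (|A|^2 - T^2/r^2)$ is nonnegative: on each sphere
$\int |\nabla_S^2 u|^2 \ge \int |\nabla_S u|^2$. If $N = 1$ both sides
vanish. If $N \ge 3$ this is the Bochner identity
$\int (\Delta_S u)^2 - |\nabla_S^2 u|^2 = (N-2) \int |\nabla_S u|^2$ together
with the Cauchy-Schwarz bound
$(\Delta_S u)^2 \le (N-1) |\nabla_S^2 u|^2$ ([sphere_gap_dim_ge3]). If
$N = 2$ it is the Wirtinger inequality on circles. That one fails on longer
circles, hence no combination of squares and divergences of local expressions
proves it; here it is integrated over the plane by averaging over all rotations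
([sphere_gap_dim2]).

All of this is done in Cartesian coordinates. The fields are $a(|x|) Y(x)$ with
$Y$ built from $x$ and from the derivatives of $u$, and supported in an annulus
$\alpha \le |x| \le \beta$ ([divergence_radial]). That the integral
of a divergence vanishes is used in a one-sided form: if $\partial_i F \le g$
with $F$ and $g$ compactly supported and $g$ continuous, then $\int g \ge 0$
([integral_tuple_partial_le]). This is what the first step needs, since $q'$ is
only bounded above by a continuous function. *)

(** * Integrals of continuous functions with bounded support *)

Lemma rat_ball (R : realType) (s d : R) :
  0 < d -> exists q : rat, ball (ratr q : R) d s.
Proof.
move=> d0; have [|q] := @rat_in_itvoo R (s - d) (s + d); first by lra.
rewrite in_itv/= => /andP[q1 q2]; exists q.
by rewrite /ball/= ltr_norml; apply/andP; split; lra.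
Qed.

Section measurability.
Context {R : realType} {n : nat}.
Local Notation T := (n.-tuple (measurableTypeR R)).

Definition tuple_rv (t : T) : 'rV[R]_n := \row_i (tnth t i : R).

Definition cube (B : R) : set 'rV[R]_n := [set x | forall i, `|x 0 i| <= B].

Lemma measurable_tuple_box (A : 'I_n -> set (measurableTypeR R)) :
  (forall i, measurable (A i)) ->
  measurable [set t : T | forall i, A i (tnth t i)].
Proof.
move=> mA; rewrite (_ : [set _ | _] = \bigcap_(i in [set: 'I_n])
    ((@tnth n (measurableTypeR R) ^~ i) @^-1` A i)).
  apply: fin_bigcap_measurable => // i _.
  by rewrite -[X in measurable X]setTI; exact: measurable_tnth.
by apply/seteqP; split => t /= h i; [move=> _; exact: h|exact: h].
Qed.

(** The Borel sets of row vectors are measurable in the product sigma-algebra of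
tuples, because an open set is the union of the countably many cubes with
rational centre and radius $1/(k+1)$ that it contains. *)
Lemma measurable_tuple_rv_open (O : set 'rV[R]_n) :
  open O -> measurable (tuple_rv @^-1` O).
Proof.
move=> oO.
pose I := ({ffun 'I_n -> rat} * nat)%type.
pose C (c : I) : set 'rV[R]_n :=
  [set x | forall i, ball (ratr (c.1 i) : R) (c.2.+1%:R^-1) (x 0 i)].
pose F (c : I) : set T := if `[< C c `<=` O >]
  then [set t | forall i, ball (ratr (c.1 i) : R) (c.2.+1%:R^-1) (tnth t i)]
  else set0.
rewrite (_ : _ @^-1` _ = \bigcup_c F c).
  apply: (@countable_bigcupT_measurable _ _ I) => [|c]; first exact: countableP.
  rewrite /F; case: asboolP => // _.
  apply: (@measurable_tuple_box
    (fun i => ball (ratr (c.1 i) : R) (c.2.+1%:R^-1))) => i.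
  by rewrite ball_itv; exact: measurable_itv.
apply/seteqP; split => [t Ot|t [c _]]; last first.
  rewrite /F; case: asboolP => // CO /= ct; apply: CO => i.
  by rewrite mxE; exact: ct.
have /nbhs_ballP[e /= e0 eO] : nbhs (tuple_rv t) O by exact: open_nbhs_nbhs.
have [k ke] : exists k : nat, k.+1%:R^-1 < e / 2.
  exists (Num.trunc (e / 2)^-1).
  rewrite invf_plt ?posrE ?divr_gt0//.
  by rewrite truncnS_gt.
have q_ i : exists q : rat, ball (ratr q : R) (k.+1%:R^-1) (tnth t i).
  by apply: rat_ball; rewrite invr_gt0.
have [q qP] := choice q_.
exists ([ffun i => q i], k) => //; rewrite /F; case: asboolP => /=.
  by move=> _ i; rewrite ffunE; exact: qP.
case=> x Cx; apply: eO; split => // a i; rewrite ord1 mxE.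
have /= := Cx i; rewrite ffunE => Cxi.
have := ball_triangle (ball_sym (qP i)) Cxi.
by apply: le_ball; rewrite [leRHS]splitr lerD// ltW.
Qed.

Lemma continuous_measurable_tuple (f : 'rV[R]_n -> R) :
  continuous f -> measurable_fun [set: T] (f \o tuple_rv).
Proof.
move=> /continuousP cf.
apply: (measurability _ (RGenOpens.measurableE R)) => _ [_ [a [b ->] <-]].
rewrite setTI comp_preimage; apply: measurable_tuple_rv_open.
by apply: cf; exact: interval_open.
Qed.

Definition continuous_in_cube (B : R) (f : 'rV[R]_n -> R) :=
  continuous f /\ forall x, ~ cube B x -> f x = 0.

Lemma bounded_continuous_in_cube B f : continuous_in_cube B f ->
  exists M, forall x, `|f x| <= M.
Proof.
move=> [cf f0].
have K : compact (cube B).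
  rewrite (_ : cube B = [set v | forall i, `[- B, B]%classic (v ord0 i)]).
    by apply: (@rV_compact R n (fun=> `[- B, B]%classic)) => i; exact: segment_compact.
  by apply/seteqP; split => x /= h i; have := h i; rewrite in_itv/= ler_norml.
have [M0 [_ HM]] : bounded_set (f @` cube B).
  apply: compact_bounded; apply: continuous_compact => //.
  exact: continuous_subspaceT.
exists (Num.max (M0 + 1) 0) => x; rewrite le_max.
have [xB|/f0->] := pselect (cube B x); last by rewrite normr0 lexx orbT.
by apply/orP; left; apply: (HM (M0 + 1)); [rewrite ltrDl|exists x].
Qed.

Lemma integrable_continuous_in_cube B f : continuous_in_cube B f ->
  (@lebesgue_tuple R n).-integrable [set: T] (EFin \o (f \o tuple_rv)).
Proof.
move=> fB; have [M HM] := bounded_continuous_in_cube fB.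
have [cf f0] := fB.
pose D : set T := [set t | forall i, `[- B, B]%classic (tnth t i)].
have mD : measurable D.
  by apply: (@measurable_tuple_box (fun=> `[- B, B]%classic)) => i; exact: measurable_itv.
have fD : (@lebesgue_tuple R n D < +oo)%E.
  rewrite (@lebesgue_tuple_box R n (fun=> `[- B, B]%classic)); last by move=> i;
    exact: measurable_itv.
  rewrite (eq_bigr (fun=> (Num.max 0 (B + B))%:E)).
    by rewrite prodEFin ltry.
  move=> i _; rewrite lebesgue_measure_itv/= lte_fin opprK.
  case: ltP => BB; rewrite ?sube_cst0//.
    by rewrite -EFinD max_r//; lra.
  by rewrite max_l//; lra.
have -> : EFin \o (f \o tuple_rv) = (EFin \o (f \o tuple_rv)) \_ D.
  apply/funext => t; rewrite patchE; case: ifPn => // /negP; rewrite inE => tD.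
  rewrite /= f0// => tB; apply: tD => i; have := tB i.
  by rewrite mxE /= in_itv/= ler_norml.
apply/(integrable_mkcond _ mD); apply: measurable_bounded_integrable => //.
  by apply: measurable_funTS; exact: continuous_measurable_tuple.
exists M; split; first by rewrite num_real.
by move=> M' MM' t _ /=; exact: le_trans (ltW MM').
Qed.

Definition integral_tuple (f : 'rV[R]_n -> R) : R :=
  Rintegral (@lebesgue_tuple R n) [set: T] (f \o tuple_rv).

Lemma integral_tupleE B f : continuous_in_cube B f ->
  (\int[@lebesgue_tuple R n]_t (f (tuple_rv t))%:E)%E = (integral_tuple f)%:E.
Proof.
move=> fB; rewrite /integral_tuple /Rintegral fineK//.
by apply: integrable_fin_num => //; exact: integrable_continuous_in_cube fB.
Qed.

End measurability.
Arguments cube {R n}.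

(** * Derivatives along lines *)

(** A directional derivative only sees the restriction to a line, so that it can
be computed after any reparametrization which is affine along that line. This
serves both for restricting a function to a line and for slicing. *)
Lemma derive_comp_affine (R : numFieldType) (U V W : normedModType R)
    (f : V -> W) (L : U -> V) a v v' :
  (forall h : R, L (h *: v + a) = h *: v' + L a) ->
  (derivable (f \o L) a v <-> derivable f (L a) v') /\
  'D_v (f \o L) a = 'D_v' f (L a).
Proof.
move=> LE; have E : (fun h : R => h^-1 *: (((f \o L) \o shift a) (h *: v) - (f \o L) a)) =
   (fun h => h^-1 *: ((f \o shift (L a)) (h *: v') - f (L a))).
  by apply/funext => h /=; rewrite LE.
by rewrite /derivable /derive E.
Qed.

Lemma is_derive_comp_affine (R : numFieldType) (U V W : normedModType R)
    (f : V -> W) (L : U -> V) a v v' df :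
  (forall h : R, L (h *: v + a) = h *: v' + L a) ->
  is_derive (L a) v' f df -> is_derive a v (f \o L) df.
Proof.
move=> /(derive_comp_affine f)[dE DE] [df1 df2]; split; first exact/dE.
by rewrite DE.
Qed.

(** * One-sided integration by parts *)

Section one_dimension.
Context {R : realType}.
Local Notation mu := (@lebesgue_measure R).

Lemma integrable_continuous_segment (g : R -> R) (a b : R) : continuous g ->
  mu.-integrable `[a, b] (EFin \o g).
Proof.
move=> cg; apply: continuous_compact_integrable; first exact: segment_compact.
exact: continuous_subspaceT.
Qed.

Lemma Rintegral_lin (a b c e : R) (f g : R -> R) :
  continuous f -> continuous g ->
  \int[mu]_(t in `[a, b]) (c * f t + e * g t) =
  c * \int[mu]_(t in `[a, b]) f t + e * \int[mu]_(t in `[a, b]) g t.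
Proof.
move=> cf cg; have mI : measurable (`[a, b]%classic : set (measurableTypeR R)).
  exact: measurable_itv.
have cM (k : R) (h : R -> R) : continuous h -> continuous (fun t => k * h t).
  by move=> ch t; apply: continuousM; [exact: cst_continuous|exact: ch].
rewrite RintegralD//.
- rewrite RintegralZl//; last exact: integrable_continuous_segment.
  by rewrite RintegralZl//; exact: integrable_continuous_segment.
- exact: (integrable_continuous_segment _ _ (cM _ _ cf)).
- exact: (integrable_continuous_segment _ _ (cM _ _ cg)).
Qed.

(** With $G$ a primitive of $g$, the function $G - F$ is nondecreasing, and its
increment over an interval containing both supports is $\int g$. No integral of
$F'$ is taken. *)
Lemma integral_ge0_derive1_le (B : R) (F g : R -> R) :
  (forall x, derivable F x 1) -> (forall x, 'D_1 F x <= g x) -> continuous g ->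
  (forall x, B < `|x| -> F x = 0) -> (forall x, B < `|x| -> g x = 0) ->
  (0 <= \int[mu]_x (g x)%:E)%E.
Proof.
move=> dF Fg cg F0 g0.
pose b := `|B| + 1; have Bb : B < b by rewrite /b; have := ler_norm B; lra.
have b0 : 0 < b by rewrite /b; have := normr_ge0 B; lra.
pose G x := (\int[mu]_(t in `[- b - 1, x]) g t)%R.
have dG x : x \in `]- b - 1, b + 1[ -> is_derive x 1 G (g x).
  rewrite in_itv/= => /andP[x1 x2].
  have [||GD GE] := @continuous_FTC1_closed R g (- b - 1) x (b + 1) x2 _ x1.
  - exact: integrable_continuous_segment.
  - exact: cg.
  by split; [exact: GD|rewrite -derive1E; exact: GE].
have GF : G (- b) - F (- b) <= G b - F b.
  have sub x : x \in `]- b, b[ -> x \in `]- b - 1, b + 1[.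
    by rewrite !in_itv/= => /andP[? ?]; apply/andP; split; lra.
  have dGF x : x \in `]- b - 1, b + 1[ ->
      is_derive x 1 (fun x => G x - F x) (g x - 'D_1 F x).
    move=> /dG ?; apply: is_deriveB; exact: derivableP.
  apply: (@ger0_derive1_ndecr R (fun x => G x - F x) (- b) b) => //; [| | |lra].
  - by move=> x /sub/dGF[].
  - by move=> x /sub/dGF[_]; rewrite derive1E => ->; rewrite subr_ge0.
  - apply: derivable_within_continuous => x.
    rewrite in_itv/= => /andP[? ?].
    have /dGF[]// : x \in `]- b - 1, b + 1[ by rewrite in_itv/=; lra.
have Gb : G (- b) = 0.
  rewrite /G (@eq_Rintegral _ _ _ _ _ (cst 0)); last first.
    move=> x; rewrite inE/= in_itv/= => /andP[_ xb] /=.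
    by rewrite g0// ler0_norm; lra.
  by rewrite Rintegral_cst// mul0r.
have -> : (\int[mu]_x (g x)%:E = (G b)%:E)%E.
  rewrite /G /Rintegral fineK; last first.
    apply: integrable_fin_num => //; exact: integrable_continuous_segment.
  rewrite [RHS]integral_mkcond; apply: eq_integral => x _.
  rewrite patchE; case: ifPn => // /negP.
  rewrite inE/= in_itv/= => /negP; rewrite negb_and -!ltNge => xb; rewrite g0//.
  by rewrite ltr_normr; case/orP: xb => xb; apply/orP; [right|left]; lra.
rewrite lee_fin; move: GF; rewrite Gb !F0 ?subr0//.
- by rewrite gtr0_norm.
- by rewrite normrN gtr0_norm.
Qed.

End one_dimension.

Section slices.
Context {R : realType} {n : nat}.

(** The row-vector counterpart of the cons that builds the measure on tuples. *)
Definition cons_rv (s : R) (y : 'rV[R]_n) : 'rV[R]_n.+1 :=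
  \row_i (if unlift ord0 i is Some j then y 0 j else s).

Lemma cons_rv0 s y : cons_rv s y 0 ord0 = s.
Proof. by rewrite mxE unlift_none. Qed.

Lemma cons_rvS s y j : cons_rv s y 0 (lift ord0 j) = y 0 j.
Proof. by rewrite mxE liftK. Qed.

Lemma tuple_rv_cons s (t : n.-tuple (measurableTypeR R)) :
  tuple_rv [the n.+1.-tuple (measurableTypeR R) of s :: t] =
  cons_rv s (tuple_rv t).
Proof.
apply/rowP => i; have [j ->|->] := unliftP ord0 i.
  by rewrite cons_rvS !mxE tnthS.
by rewrite cons_rv0 mxE.
Qed.

Lemma cons_rv_line0 (s h : R) y :
  cons_rv (h + s) y = h *: delta_mx 0 ord0 + cons_rv s y.
Proof.
apply/rowP => i; have [j ->|->] := unliftP ord0 i.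
  by rewrite [RHS]mxE !cons_rvS !mxE/= mulr0 add0r.
by rewrite [RHS]mxE !cons_rv0 !mxE/= mulr1.
Qed.

Lemma cons_rv_lineS (s h : R) y j :
  cons_rv s (h *: delta_mx 0 j + y) =
  h *: delta_mx 0 (lift ord0 j) + cons_rv s y.
Proof.
apply/rowP => i; have [k ->|->] := unliftP ord0 i.
  by rewrite [RHS]mxE !cons_rvS !mxE/= (inj_eq lift_inj).
by rewrite [RHS]mxE !cons_rv0 !mxE/= mulr0 add0r.
Qed.

Lemma cons_rv_continuous (s : R) : continuous (cons_rv s).
Proof.
move=> y A /nbhs_ballP[e /= e0 eA]; apply/nbhs_ballP; exists e => //= z [_ yz].
apply: eA; split => // a i; rewrite (ord1 a); have [k ->|->] := unliftP ord0 i.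
  by rewrite !cons_rvS; exact: yz.
by rewrite !cons_rv0; exact: ballxx.
Qed.

Lemma cons_rv_continuous0 y : continuous (cons_rv ^~ y).
Proof.
move=> s A /nbhs_ballP[e /= e0 eA]; apply/nbhs_ballP; exists e => //= z yz.
apply: eA; split => // a i; rewrite (ord1 a); have [k ->|->] := unliftP ord0 i.
  by rewrite !cons_rvS; exact: ballxx.
by rewrite !cons_rv0.
Qed.

Lemma cube_cons B s y : cube B (cons_rv s y) -> `|s| <= B /\ cube B y.
Proof.
move=> c; split; first by have := c ord0; rewrite cons_rv0.
by move=> i; have := c (lift ord0 i); rewrite cons_rvS.
Qed.

Lemma continuous_in_cube_cons B g s : continuous_in_cube B g ->
  continuous_in_cube B (fun y => g (cons_rv s y)).
Proof.
move=> [cg g0]; split => [y|y yB].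
  by apply: (continuous_comp (cons_rv_continuous (s := s) (x := y))); exact: cg.
by apply: g0 => /cube_cons[].
Qed.

Lemma integral_tuple_prod B (g : 'rV[R]_n.+1 -> R) : continuous_in_cube B g ->
  let f := fun p : measurableTypeR R * n.-tuple (measurableTypeR R) =>
             (g (cons_rv p.1 (tuple_rv p.2)))%:E in
  (product_measure1 (@lebesgue_measure R) (@lebesgue_tuple R n)).-integrable setT f /\
  (integral_tuple g)%:E =
    (\int[product_measure1 (@lebesgue_measure R) (@lebesgue_tuple R n)]_p f p)%E.
Proof.
move=> gB f.
pose cons (p : measurableTypeR R * n.-tuple (measurableTypeR R)) :=
  [the n.+1.-tuple (measurableTypeR R) of p.1 :: p.2].
have mcons : measurable_fun setT cons by exact: measurable_cons.
have fE : f = (EFin \o (g \o tuple_rv)) \o cons.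
  by apply/funext => -[s t]; rewrite /f /cons /comp tuple_rv_cons.
have mg : measurable_fun setT (EFin \o (g \o @tuple_rv R n.+1)).
  by apply/measurable_EFinP; apply: continuous_measurable_tuple; case: gB.
have intf : (product_measure1 (@lebesgue_measure R) (@lebesgue_tuple R
  n)).-integrable setT f.
  apply/integrableP; split; first by rewrite fE; exact: measurableT_comp.
  have /integrableP[_] := integrable_continuous_in_cube gB.
  rewrite [X in (X < _)%E -> _](_ : _ = (\int[pushforward (product_measure1
    (@lebesgue_measure R) (@lebesgue_tuple R n)) cons]_(x in setT) (`|EFin (g
      (tuple_rv x))|)%E)%E); last by [].
  rewrite ge0_integral_pushforward//.
  - by rewrite preimage_setT fE.
  - exact: measurableT_comp.
split => //.
rewrite -(integral_tupleE gB) fE.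
have := @integral_pushforward _ _ _ _ R cons mcons
  (product_measure1 (@lebesgue_measure R) (@lebesgue_tuple R n)) setT _ mg.
rewrite preimage_setT -fE; exact.
Qed.

End slices.

(** By induction on the dimension: if the direction of derivation is the first
axis, integrate first along it; otherwise apply the induction hypothesis to the
slices orthogonal to the first axis. Fubini exchanges the two orders. *)
Lemma integral_tuple_partial_le (R : realType) n (i : 'I_n) B
    (F g : 'rV[R]_n -> R) :
  (forall x, derivable F x (delta_mx 0 i)) -> (forall x, partial i F x <= g x) ->
  (forall x, ~ cube B x -> F x = 0) -> continuous_in_cube B g ->
  0 <= integral_tuple g.
Proof.
elim: n => [|n IH] in i F g *; first by case: i.
move=> dF Fg F0 gB; have [ig gE] := integral_tuple_prod gB.
rewrite -lee_fin gE; have [j ij|i0] := unliftP ord0 i.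
  rewrite -integral12_prod_meas1//; apply: integral_ge0 => s _.
  have gsB := @continuous_in_cube_cons R n B g s gB.
  rewrite /fubini_F/= (integral_tupleE gsB) lee_fin.
  apply: (IH j (F \o cons_rv s)) gsB => [y|y|y yB].
  - by apply/(derive_comp_affine F (fun h => cons_rv_lineS s h y j)).1; rewrite -ij.
  - rewrite /partial (derive_comp_affine F (fun h => cons_rv_lineS s h y j)).2 -ij.
    exact: Fg.
  - by apply: F0 => /cube_cons[].
rewrite -integral21_prod_meas1//; apply: integral_ge0 => t _.
rewrite /fubini_G/=; set y := tuple_rv t.
have L (s h : R) : cons_rv (h *: 1 + s) y = h *: delta_mx 0 ord0 + cons_rv s y.
  by rewrite -cons_rv_line0 [h *: 1]mulr1.
have big s : B < `|s| -> ~ cube B (cons_rv s y).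
  by move=> sB /cube_cons[]; rewrite leNgt sB.
have [cg g0] := gB.
have gc : continuous (fun s => g (cons_rv s y)).
  move=> s; apply: (continuous_comp (cons_rv_continuous0 (y := y) (x := s))).
  exact: cg.
apply: (@integral_ge0_derive1_le R B (fun s => F (cons_rv s y))) => [s|s||s sB|s sB].
- by apply/(derive_comp_affine F (L s)).1; rewrite -i0.
- by rewrite (derive_comp_affine F (L s)).2 -i0; exact: Fg.
- exact: gc.
- by apply: F0; exact: big.
- by apply: g0; exact: big.
Qed.

(** * Symmetry of second derivatives *)

Lemma eq_of_scaled_eq (R : realType) (h a b s t : R) : h != 0 ->
  s = t -> s = a * h * h -> t = b * h * h -> a = b.
Proof. by move=> h0 -> -> /(mulIf h0)/(mulIf h0). Qed.

Lemma dist_le_split (R : realType) (e a b c c' : R) : c = c' ->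
  `|a - c'| <= e / 2 -> `|b - c| <= e / 2 -> `|a - b| <= e.
Proof.
move=> <- ac bc; rewrite -(subrK c a) -addrA (le_trans (ler_normD _ _))//.
by rewrite [leRHS]splitr lerD// distrC.
Qed.

Section line_calculus.
Context {R : realType} {n : nat}.
Implicit Types (f : 'rV[R]_n -> R) (x v : 'rV[R]_n).

Lemma is_derive_line f x v (t : R) : derivable f (t *: v + x) v ->
  is_derive t 1 (fun s : R => f (s *: v + x)) ('D_v f (t *: v + x)).
Proof.
move=> /derivableP; apply: (is_derive_comp_affine (L := fun s : R => s *: v + x)).
by move=> h; rewrite scalerDl addrA [h *: 1]mulr1.
Qed.

Lemma MVT_line f x v (h : R) : 0 < h -> (forall y, derivable f y v) ->
  exists2 c, 0 < c < h & f (h *: v + x) - f x = 'D_v f (c *: v + x) * h.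
Proof.
move=> h0 df.
have [|s sh|c] := @MVT R (fun s => f (s *: v + x)) (fun s => 'D_v f (s *: v + x)) 0 h h0.
- by move=> s _; exact: is_derive_line.
- have : {within `[0, h], continuous (fun s : R => f (s *: v + x))}.
    by apply: derivable_within_continuous => t _;
      case: (is_derive_line (x := x) (df (t *: v + x))).
  exact.
- by rewrite in_itv/= scale0r add0r subr0 => ch ->; exists c.
Qed.

(** Two applications of the mean value theorem express the second difference of
$f$ over a small square through a mixed derivative at a nearby point. The second
difference is symmetric in $i$ and $j$, which yields [partialC]. *)
Lemma mixed_difference f x (i j : 'I_n) (h : R) : 0 < h ->
  (forall y, derivable f y (delta_mx 0 i)) ->
  (forall y, derivable (partial i f) y (delta_mx 0 j)) ->
  exists y, ball x (h + h) y /\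
    f (h *: delta_mx 0 i + (h *: delta_mx 0 j + x)) - f (h *: delta_mx 0 j + x)
      - f (h *: delta_mx 0 i + x) + f x = partial j (partial i f) y * h * h.
Proof.
move=> h0 di dj.
pose g y := f (h *: delta_mx 0 j + y) - f y.
have dg y : is_derive y (delta_mx 0 i) g
    (partial i f (h *: delta_mx 0 j + y) - partial i f y).
  apply: is_deriveB; last exact: derivableP.
  apply: (@is_derive_comp_affine R _ _ _ f (fun y => h *: delta_mx 0 j + y) y
    (delta_mx 0 i) (delta_mx 0 i)); last exact: derivableP.
  by move=> k; rewrite addrCA.
have [|c c0h gE] := @MVT_line g x (delta_mx 0 i) h h0; first by move=> y; case: (dg y).
have [d d0h hE] := @MVT_line (partial i f) (c *: delta_mx 0 i + x) (delta_mx 0 j) h h0 dj.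
exists (d *: delta_mx 0 j + (c *: delta_mx 0 i + x)); split.
  move: c0h d0h => /andP[c0 ch] /andP[d0 dh]; split; first by lra.
  move=> a b; rewrite !mxE /ball/= addrA opprD addrCA subrr addr0 normrN.
  by case: (_ && _); case: (_ && _);
    rewrite ?mulr1 ?mulr0 ?addr0 ?add0r ?normr0 ?gtr0_norm; lra.
rewrite /partial in hE *; rewrite -hE.
have [_ gi] := dg (c *: delta_mx 0 i + x); rewrite gi /partial in gE.
rewrite -gE /g addrCA; ring.
Qed.

Lemma partialC f (i j : 'I_n) x :
  (forall y, derivable f y (delta_mx 0 i)) ->
  (forall y, derivable f y (delta_mx 0 j)) ->
  (forall y, derivable (partial i f) y (delta_mx 0 j)) ->
  (forall y, derivable (partial j f) y (delta_mx 0 i)) ->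
  {for x, continuous (partial j (partial i f))} ->
  {for x, continuous (partial i (partial j f))} ->
  partial i (partial j f) x = partial j (partial i f) x.
Proof.
move=> di dj dij dji /cvgrPdist_lt cij /cvgrPdist_lt cji.
apply/eqP; rewrite -subr_eq0 -normr_le0; apply/ler_addgt0Pr => e e0; rewrite add0r.
have e20 : 0 < e / 2 by rewrite divr_gt0.
have : nbhs x (fun y =>
    `|partial j (partial i f) x - partial j (partial i f) y| < e / 2 /\
    `|partial i (partial j f) x - partial i (partial j f) y| < e / 2).
  by apply: filterI; [exact: cij|exact: cji].
move=> /nbhs_ballP[r /= r0 Hr].
have [h h0 hr] : exists2 h, 0 < h & h + h <= r.
  by exists (r / 2); [rewrite divr_gt0|rewrite -splitr].
have [y [xy yE]] := mixed_difference x h0 di dij.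
have [z [xz zE]] := mixed_difference x h0 dj dji.
have yz : partial j (partial i f) y = partial i (partial j f) z.
  apply: (eq_of_scaled_eq (lt0r_neq0 h0)) _ yE zE; congr (_ + _).
  by rewrite addrAC (addrCA (h *: delta_mx 0 i)).
have [/ltW Hy _] := Hr _ (le_ball hr xy); have [_ /ltW Hz] := Hr _ (le_ball hr xz).
exact: dist_le_split yz Hz Hy.
Qed.

End line_calculus.

(** * Continuously differentiable functions and the Euclidean norm *)

Lemma is_derive_chain (R : realType) (V : normedModType R) (f : V -> R)
    (g : R -> R) x v df dg :
  is_derive (f x) 1 g dg -> is_derive x v f df ->
  is_derive x v (g \o f) (dg * df).
Proof.
move=> dg1 df1.
have L0 : 0 *: v + x = x by rewrite scale0r add0r.
pose L (s : R) := s *: v + x.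
have LE (h : R) : L (h *: 1 + 0) = h *: v + L 0.
  by rewrite /L L0 addr0 [h *: 1]mulr1.
have [cE DE] := derive_comp_affine (g \o f) LE.
have [c1 D1] : is_derive (0 : R) 1 (g \o (f \o L)) (dg * df).
  apply: is_derive1_comp; first by rewrite /= /L L0.
  by apply: is_derive_comp_affine LE _; rewrite /L L0.
split; first by move/cE : c1; rewrite /L L0.
by rewrite -D1 [RHS]DE /L L0.
Qed.

Lemma continuous_sum (R : realType) (T : topologicalType) (I : Type)
    (s : seq I) (f : I -> T -> R) x :
  (forall k, {for x, continuous (f k)}) ->
  {for x, continuous (fun y => \sum_(k <- s) f k y)}.
Proof.
move=> cf; elim: s => [|k s IH].
  rewrite (_ : (fun _ => _) = fun=> 0); first exact: cst_continuous.
  by apply/funext => y; rewrite big_nil.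
rewrite (_ : (fun _ => _) = fun y => f k y + \sum_(k <- s) f k y).
  exact: continuousD.
by apply/funext => y; rewrite big_cons.
Qed.

Section enorm.
Context {R : realType} {N : nat}.
Implicit Types (x : 'rV[R]_N).

Lemma enorm_ge0 x : 0 <= enorm x. Proof. exact: sqrtr_ge0. Qed.

Lemma enorm_sqr x : enorm x ^+ 2 = \sum_i x 0 i ^+ 2.
Proof. by rewrite sqr_sqrtr// sumr_ge0// => i _; exact: sqr_ge0. Qed.

Lemma ler_coord_enorm x i : `|x 0 i| <= enorm x.
Proof.
rewrite -(ler_pXn2r (n := 2))// ?nnegrE ?enorm_ge0//.
rewrite enorm_sqr real_normK ?num_real// (bigD1 i)//= lerDl.
by apply: sumr_ge0 => j _; exact: sqr_ge0.
Qed.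

Lemma enorm_continuous : continuous (@enorm R N).
Proof.
move=> x; apply: (continuous_comp (f := fun x => \sum_i x 0 i ^+ 2)); last first.
  exact: sqrt_continuous.
apply: continuous_sum => i;
  apply: (continuous_comp (f := fun x : 'rV[R]_N => x 0 i) (g := fun y => y ^+ 2)).
  exact: coord_continuous.
exact: exprn_continuous.
Qed.

End enorm.

Section C1.
Context {R : realType} {N : nat}.
Implicit Types (x : 'rV[R]_N) (f g : 'rV[R]_N -> R) (df dg : 'I_N -> 'rV[R]_N -> R).

Lemma is_derive_coord x (i j : 'I_N) :
  is_derive x (delta_mx 0 i) (fun x : 'rV[R]_N => x 0 j) ((j == i)%:R).
Proof.
have E : (fun h : R => h^-1 *: (((fun x : 'rV[R]_N => x 0 j) \o shift x) (h *:
  delta_mx 0 i) - x 0 j))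
   @ 0^' --> ((j == i)%:R : R).
  apply: (@cvg_trans _ ((fun=> (j == i)%:R : R) @ 0^')); last exact: cvg_cst.
  apply: near_eq_cvg; near=> h; rewrite /= !mxE addrK /= [RHS]mulrA mulVf ?mul1r//.
  by near: h; exact: nbhs_dnbhs_neq.
split; first by apply/cvg_ex; exists (j == i)%:R.
exact/cvg_lim.
Unshelve. all: by end_near. Qed.

(** The gradient is carried along as data, so that the divergence of a field built
from the closure lemmas below can be read off its construction. *)
Definition C1 f df := continuous f /\ forall i,
  (forall x, is_derive x (delta_mx 0 i) f (df i x)) /\ continuous (df i).

Lemma C1_eq f df df' : C1 f df -> (forall i x, df i x = df' i x) -> C1 f df'.
Proof.
by move=> fdf e; rewrite (_ : df' = df)//; apply/funext => i; apply/funext => x.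
Qed.

Lemma C1_cst (c : R) : C1 (fun=> c) (fun _ _ => 0).
Proof.
split=> [|i]; first exact: cst_continuous.
by split => [x|]; [exact: is_derive_cst|exact: cst_continuous].
Qed.

Lemma C1_coord j : C1 (fun x : 'rV[R]_N => x 0 j) (fun i _ => (j == i)%:R).
Proof.
split=> [x|i]; first exact: coord_continuous.
by split => [x|]; [exact: is_derive_coord|exact: cst_continuous].
Qed.

Lemma C1D f df g dg : C1 f df -> C1 g dg ->
  C1 (fun x => f x + g x) (fun i x => df i x + dg i x).
Proof.
move=> [cf fdf] [cg gdg]; split=> [x|i]; first by apply: continuousD;
  [exact: cf|exact: cg].
have [f1 f2] := fdf i; have [g1 g2] := gdg i.
by split=> x; [exact: is_deriveD|apply: continuousD; [exact: f2|exact: g2]].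
Qed.

Lemma C1M f df g dg : C1 f df -> C1 g dg ->
  C1 (fun x => f x * g x) (fun i x => df i x * g x + f x * dg i x).
Proof.
move=> [cf fdf] [cg gdg]; split=> [x|i]; first by apply: continuousM;
  [exact: cf|exact: cg].
have [f1 f2] := fdf i; have [g1 g2] := gdg i; split=> x.
  apply: (is_derive_eq (is_deriveM (f1 x) (g1 x))).
  by rewrite addrC [g x *: _]mulrC.
by apply: (@continuousD _ _ _ (fun x => df i x * g x) (fun x => f x * dg i x));
  apply: continuousM; [exact: f2|exact: cg|exact: cf|exact: g2].
Qed.

Lemma C1N f df : C1 f df -> C1 (fun x => - f x) (fun i x => - df i x).
Proof.
move=> [cf fdf]; split=> [x|i]; first by apply: continuousN; exact: cf.
by have [f1 f2] := fdf i; split=> x; [exact: is_deriveN|apply: continuousN; exact: f2].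
Qed.

Lemma C1B f df g dg : C1 f df -> C1 g dg ->
  C1 (fun x => f x - g x) (fun i x => df i x - dg i x).
Proof. by move=> fC gC; exact: C1D fC (C1N gC). Qed.

Lemma C1_sum (I : finType) (f : I -> 'rV[R]_N -> R)
    (df : I -> 'I_N -> 'rV[R]_N -> R) :
  (forall k, C1 (f k) (df k)) ->
  C1 (fun x => \sum_k f k x) (fun i x => \sum_k df k i x).
Proof.
move=> fC; rewrite unlock; elim: (index_enum I) => [|k s IH] /=.
  exact: C1_cst.
exact: C1D.
Qed.

End C1.

Section enorm_derive.
Context {R : realType} {N : nat}.
Implicit Types (x : 'rV[R]_N).

Lemma is_derive_enorm x i : 0 < enorm x ->
  is_derive x (delta_mx 0 i) enorm (x 0 i / enorm x).
Proof.
move=> x0; have d2 : is_derive x (delta_mx 0 i) (fun x => \sum_j x 0 j ^+ 2) (2 * x 0 i).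
  rewrite (_ : (fun _ => _) = fun x : 'rV[R]_N => \sum_j x 0 j * x 0 j); last first.
    by apply/funext => y; apply: eq_bigr => j _; rewrite expr2.
  have [_ /(_ i)[/(_ x) dx _]] := C1_sum (fun j => C1M (@C1_coord R N j) (C1_coord j)).
  apply: (is_derive_eq dx).
  rewrite (bigD1 i)//= eqxx big1 ?addr0 => [|j /negPf->];
    first by rewrite mul1r mulr1 mulr_natl.
  by rewrite mul0r mulr0 addr0.
have s0 : 0 < \sum_j x 0 j ^+ 2 by rewrite -enorm_sqr exprn_gt0.
apply: (is_derive_eq (is_derive_chain (is_derive1_sqrt s0) d2)).
rewrite -/(enorm x); field; by rewrite gt_eqF.
Qed.

End enorm_derive.

Lemma is_derive_divX (R : realType) (f : R -> R) (f' : R) (n : nat) (r : R) : 0 < r ->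
  is_derive r 1 f f' ->
  is_derive r 1 (fun r => f r / r ^+ n) (f' / r ^+ n - n%:R * f r / r ^+ n.+1).
Proof.
move=> r0 df; have rn0 : r ^+ n != 0 by rewrite expf_neq0// lt0r_neq0.
have dX : is_derive r 1 (fun r : R => r ^+ n) (n%:R * r ^+ n.-1).
  by split; [exact: exprn_derivable|rewrite exp_derive [_ *: 1]mulr1].
have dV : is_derive r 1 (fun r : R => (r ^+ n)^-1)
    (- (r ^+ n) ^- 2 *: (n%:R * r ^+ n.-1)) by exact: is_deriveV.
apply: (is_derive_eq (is_deriveM df dV)).
case: n => [|n] in rn0 dX dV *; rewrite /GRing.scale/=.
  by rewrite !mul0r expr0 invr1 mulr0 subr0; ring.
have rN := lt0r_neq0 r0; rewrite !exprS; field; rewrite ?expf_neq0 ?rN//=.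
Qed.

Lemma continuous_divX (R : realType) (f : R -> R) (n : nat) (r : R) : 0 < r ->
  {for r, continuous f} -> {for r, continuous (fun r => f r / r ^+ n)}.
Proof.
move=> r0 cf; apply: continuousM => //.
apply: (@continuousV _ _ (fun r : R => r ^+ n)); last exact: exprn_continuous.
by rewrite expf_neq0// lt0r_neq0.
Qed.

(** * Divergence of fields with a radial weight *)

Section annulus.
Context {R : realType} {N : nat} (al be : R).
Hypothesis al0 : 0 < al.
Implicit Types (x : 'rV[R]_N) (f g : 'rV[R]_N -> R).

Definition annulus : set 'rV[R]_N := [set x | al <= enorm x <= be].

Lemma annulus_cube x : annulus x -> cube be x.
Proof. by move=> /andP[_ xb] i; exact: le_trans (ler_coord_enorm x i) xb. Qed.

Lemma annulus_gt0 x : annulus x -> 0 < enorm x.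
Proof. by move=> /andP[+ _]; exact: lt_le_trans. Qed.

(** A function that vanishes off the annulus vanishes near each point off it,
hence is continuous and has zero derivatives there. *)
Lemma near_notin_annulus x : ~ annulus x -> \forall y \near x, ~ annulus y.
Proof.
move=> xA; have oA : open (~` annulus).
  rewrite openC.
  rewrite (_ : annulus = enorm @^-1` `[al, be]%classic).
    apply: closed_comp => [y _|]; [exact: enorm_continuous|exact: interval_closed].
  by apply/seteqP; split=> y /=; rewrite in_itv.
exact: (open_nbhs_nbhs (conj oA xA)).
Qed.

Definition in_annulus f := (forall x, annulus x -> {for x, continuous f}) /\
  (forall x, ~ annulus x -> f x = 0).

Lemma in_annulus_cube f : in_annulus f -> continuous_in_cube be f.
Proof.
move=> [cf f0]; split; last by move=> x xc; apply: f0 => /annulus_cube.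
move=> x; have [|xA] := pselect (annulus x); first exact: cf.
rewrite /continuous_at f0//; apply: (@cvg_near_cst _ _ _ f (nbhs x)).
by apply: filterS (near_notin_annulus xA) => y /f0.
Qed.

Lemma in_annulus_ext f g : in_annulus f -> f =1 g -> in_annulus g.
Proof. by move=> fA /funext <-. Qed.

Lemma in_annulusD f g : in_annulus f -> in_annulus g ->
  in_annulus (fun x => f x + g x).
Proof.
move=> [cf f0] [cg g0]; split => x xA; last by rewrite f0// g0// addr0.
by apply: continuousD; [exact: cf|exact: cg].
Qed.

Lemma in_annulusN f : in_annulus f -> in_annulus (fun x => - f x).
Proof.
move=> [cf f0]; split => x xA; last by rewrite f0// oppr0.
by apply: continuousN; exact: cf.
Qed.

Lemma in_annulusB f g : in_annulus f -> in_annulus g ->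
  in_annulus (fun x => f x - g x).
Proof. by move=> fA gA; exact: in_annulusD fA (in_annulusN gA). Qed.

Lemma in_annulusMl f g : (forall x, annulus x -> {for x, continuous f}) ->
  in_annulus g -> in_annulus (fun x => f x * g x).
Proof.
move=> cf [cg g0]; split => x xA; last by rewrite g0// mulr0.
by apply: continuousM; [exact: cf|exact: cg].
Qed.

Lemma in_annulusZ (c : R) f : in_annulus f -> in_annulus (fun x => c * f x).
Proof. by apply: in_annulusMl => x _; exact: cst_continuous. Qed.

Lemma in_annulus_sum (I : finType) (f : I -> 'rV[R]_N -> R) :
  (forall k, in_annulus (f k)) -> in_annulus (fun x => \sum_k f k x).
Proof.
move=> fA; split=> x xA; last by rewrite big1// => k _; have [_ ->] := fA k.
by apply: continuous_sum => k; have [+ _] := fA k; exact.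
Qed.

Lemma in_annulusM f g : in_annulus f -> in_annulus g ->
  in_annulus (fun x => f x * g x).
Proof. by move=> [cf _]; exact: in_annulusMl. Qed.

Lemma in_annulus_radialM (a : R -> R) f :
  (forall r, al <= r <= be -> {for r, continuous a}) ->
  in_annulus f -> in_annulus (fun x => a (enorm x) * f x).
Proof.
move=> ca; apply: in_annulusMl => x xA.
by apply: (continuous_comp (enorm_continuous (x := x))); exact: ca.
Qed.

Lemma in_annulus_C1_derive f df i : C1 f df ->
  (forall x, ~ annulus x -> f x = 0) -> in_annulus (df i).
Proof.
move=> [_ fC] f0; split=> x xA; first exact: (fC i).2.
have [/(_ x)[_ <-] _] := fC i.
rewrite (@near_eq_derive _ _ _ _ (fun=> 0)) ?derive_cst//.
by apply: filterS (near_notin_annulus xA) => y; exact: f0.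
Qed.

Lemma in_annulus_divX f n : in_annulus f ->
  in_annulus (fun x => f x / enorm x ^+ n).
Proof.
move=> fA; apply: (@in_annulus_ext (fun x => 1 / enorm x ^+ n * f x)).
  apply: (in_annulus_radialM (a := fun r => 1 / r ^+ n)) => // r /andP[rA _].
  by apply: continuous_divX; [exact: lt_le_trans rA|exact: cst_continuous].
by move=> x; rewrite mul1r mulrC.
Qed.

Lemma integral_tupleD f g : in_annulus f -> in_annulus g ->
  integral_tuple (fun x => f x + g x) = integral_tuple f + integral_tuple g.
Proof.
move=> /in_annulus_cube/integrable_continuous_in_cube fi.
move=> /in_annulus_cube/integrable_continuous_in_cube gi.
exact: RintegralD.
Qed.

Lemma integral_tupleZ (c : R) f : in_annulus f ->
  integral_tuple (fun x => c * f x) = c * integral_tuple f.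
Proof.
move=> /in_annulus_cube/integrable_continuous_in_cube fi.
exact: RintegralZl.
Qed.

Lemma le_integral_tuple f g : in_annulus f -> in_annulus g ->
  (forall x, annulus x -> f x <= g x) -> integral_tuple f <= integral_tuple g.
Proof.
move=> fA gA fg; apply: le_Rintegral => //.
- exact: integrable_continuous_in_cube (in_annulus_cube fA).
- exact: integrable_continuous_in_cube (in_annulus_cube gA).
- move=> t _ /=; set x := tuple_rv t.
  have [|xA] := pselect (annulus x); first exact: fg.
  by rewrite fA.2// gA.2.
Qed.

(** Both predicates include the regularity that makes the integral additive. *)
Definition integral_pos f := in_annulus f /\ 0 <= integral_tuple f.

Definition integral_null f := in_annulus f /\ integral_tuple f = 0.

Lemma integral_null_ext f g : integral_null f -> f =1 g -> integral_null g.
Proof. by move=> fN /funext <-. Qed.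

Lemma integral_nullW f : integral_null f -> integral_pos f.
Proof. by move=> [fA f0]; split; rewrite // f0. Qed.

Lemma integral_posD f g : integral_pos f -> integral_pos g ->
  integral_pos (fun x => f x + g x).
Proof.
move=> [fA f0] [gA g0]; split; first exact: in_annulusD.
by rewrite integral_tupleD// addr_ge0.
Qed.

Lemma integral_posZ (c : R) f : 0 <= c -> integral_pos f ->
  integral_pos (fun x => c * f x).
Proof.
move=> c0 [fA f0]; split; first exact: in_annulusZ.
by rewrite integral_tupleZ// mulr_ge0.
Qed.

Lemma integral_nullD f g : integral_null f -> integral_null g ->
  integral_null (fun x => f x + g x).
Proof.
move=> [fA f0] [gA g0]; split; first exact: in_annulusD.
by rewrite integral_tupleD// f0 g0 addr0.
Qed.

Lemma integral_nullZ (c : R) f : integral_null f ->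
  integral_null (fun x => c * f x).
Proof.
move=> [fA f0]; split; first exact: in_annulusZ.
by rewrite integral_tupleZ// f0 mulr0.
Qed.

Lemma integral_pos_le f g : integral_pos f -> in_annulus g ->
  (forall x, annulus x -> f x <= g x) -> integral_pos g.
Proof.
move=> [fA f0] gA fg; split=> //.
exact: le_trans f0 (le_integral_tuple fA gA fg).
Qed.

Lemma integral_pos_sum (I : finType) (f : I -> 'rV[R]_N -> R) :
  (forall k, integral_pos (f k)) -> integral_pos (fun x => \sum_k f k x).
Proof.
move=> fP; rewrite unlock; elim: (index_enum I) => [|k s IH] /=.
  split; first by split=> // x _; exact: cst_continuous.
  exact: Rintegral_ge0.
exact: integral_posD.
Qed.

(** The integrand dominates $\sum_i \partial_i (a(|x|) Y_i)$, because
$\partial_i (a(|x|)) = a'(|x|) x_i / |x|$. The bound of $a'$ by the continuous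
$b$ is only asked after multiplication by $x_i Y_i$, so that it may be one-sided
when this product is nonnegative, and an equality otherwise. *)
Lemma divergence_radial_le (a b : R -> R) (Y : 'I_N -> 'rV[R]_N -> R)
    (dY : 'I_N -> 'I_N -> 'rV[R]_N -> R) :
  (forall r, al <= r <= be -> derivable a r 1) ->
  (forall r, al <= r <= be -> {for r, continuous b}) ->
  (forall i, C1 (Y i) (dY i)) ->
  (forall i x, ~ annulus x -> Y i x = 0) ->
  (forall i x, annulus x ->
     'D_1 a (enorm x) * (x 0 i * Y i x) <= b (enorm x) * (x 0 i * Y i x)) ->
  integral_pos (fun x => b (enorm x) / enorm x * (\sum_i x 0 i * Y i x) +
                         a (enorm x) * \sum_i dY i i x).
Proof.
move=> da cb YC Y0 ab.
have ca r : al <= r <= be -> {for r, continuous a}.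
  by move=> /da /derivable1_diffP/differentiable_continuous.
have YA i : in_annulus (Y i).
  by split=> x xA; [exact: (YC i).1|exact: Y0].
have dYA i : in_annulus (dY i i).
  exact: in_annulus_C1_derive (YC i) (Y0 i).
pose g i x := b (enorm x) / enorm x * (x 0 i * Y i x) + a (enorm x) * dY i i x.
have gA i : in_annulus (g i).
  apply: in_annulusD; last exact: in_annulus_radialM.
  apply: (in_annulus_radialM (a := fun r => b r / r)) => [r rA|].
    apply: continuousM; first exact: cb.
    by apply: inv_continuous; have := al0; lra.
  apply: in_annulusMl => // x _; exact: coord_continuous.
suff H i : integral_pos (g i).
  apply: (integral_pos_le (integral_pos_sum H)).
    apply: in_annulus_ext (in_annulus_sum gA) _ => x.
    by rewrite big_split/= -!mulr_sumr.
  by move=> x xA; rewrite big_split/= -!mulr_sumr.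
split; first exact: gA.
pose F x := a (enorm x) * Y i x.
have F0 x : ~ annulus x -> F x = 0 by move=> xA; rewrite /F Y0// mulr0.
have dF x : annulus x -> is_derive x (delta_mx 0 i) F
    ('D_1 a (enorm x) / enorm x * (x 0 i * Y i x) + a (enorm x) * dY i i x).
  move=> xA; have x0 := annulus_gt0 xA.
  have d1 := is_derive_chain (derivableP (da _ xA)) (is_derive_enorm i x0).
  apply: (is_derive_eq (is_deriveM d1 (((YC i).2 i).1 x))).
  rewrite [_ *: _]mulrC [X in _ + X]mulrC /=; ring.
have dF0 x : ~ annulus x -> is_derive x (delta_mx 0 i) F 0.
  move=> xA; apply: (@near_eq_is_derive _ _ _ (fun=> 0)).
  by apply: filterS (near_notin_annulus xA) => y /F0.
apply: (@integral_tuple_partial_le _ _ i be F).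
- move=> x; have [xA|xA] := pselect (annulus x); first by case: (dF _ xA).
  by case: (dF0 _ xA).
- move=> x; rewrite /partial; have [xA|xA] := pselect (annulus x); last first.
    by case: (dF0 _ xA) => _ ->; rewrite (gA i).2.
  case: (dF _ xA) => _ ->; rewrite lerD2r -!mulrA ![(enorm x)^-1 * _]mulrC !mulrA.
  by rewrite ler_pM2r ?invr_gt0 ?(annulus_gt0 xA)// -!mulrA; exact: ab.
- by move=> x xc; apply: F0 => /annulus_cube.
- exact: in_annulus_cube.
Qed.

Lemma divergence_radial (a a' : R -> R) (Y : 'I_N -> 'rV[R]_N -> R)
    (dY : 'I_N -> 'I_N -> 'rV[R]_N -> R) :
  (forall r, al <= r <= be -> is_derive r 1 a (a' r)) ->
  (forall r, al <= r <= be -> {for r, continuous a'}) ->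
  (forall i, C1 (Y i) (dY i)) ->
  (forall i x, ~ annulus x -> Y i x = 0) ->
  integral_null (fun x => a' (enorm x) / enorm x * (\sum_i x 0 i * Y i x) +
                         a (enorm x) * \sum_i dY i i x).
Proof.
move=> da ca' YC Y0.
have da1 r : al <= r <= be -> derivable a r 1 by move=> /da[].
have [fA f0] : integral_pos (fun x => a' (enorm x) / enorm x * (\sum_i x 0 i * Y i x) +
                         a (enorm x) * \sum_i dY i i x).
  apply: divergence_radial_le => // i x /da[_ ->//].
have [gA g0] : integral_pos (fun x => a' (enorm x) / enorm x * (\sum_i x 0 i *
  (- Y i x)) +
                         a (enorm x) * \sum_i (- dY i i x)).
  apply: (divergence_radial_le (Y := fun i x => - Y i x)
     (dY := fun i j x => - dY i j x)) => // [i|i x xA|i x /da[_ ->//]].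
    exact: C1N.
  by rewrite Y0// oppr0.
split=> //; apply/eqP; rewrite eq_le f0 andbT -oppr_ge0 -mulN1r -integral_tupleZ//.
rewrite (_ : (fun _ => _) = (fun x => a' (enorm x) / enorm x * (\sum_i x 0 i *
  (- Y i x)) +
                         a (enorm x) * \sum_i (- dY i i x)))//.
apply/funext => x; rewrite sumrN mulN1r opprD -!mulrN; congr (_ * _ + _).
by rewrite -sumrN; apply: eq_bigr => i _; rewrite mulrN.
Qed.

End annulus.

(** * Integral identities for a function and its derivatives *)

Lemma sum_ord1 (R : realType) n : n = 1%N ->
  exists i0 : 'I_n, forall F : 'I_n -> R, \sum_i F i = F i0.
Proof. by move=> ->; exists ord0 => F; rewrite big_ord1. Qed.

Section fields.
Context {R : realType} {N : nat} (al be : R).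
Hypothesis al0 : 0 < al.
Local Notation V := 'rV[R]_N.
Local Notation annulus := (@annulus R N al be).
Local Notation integral_null := (@integral_null R N al be).
Local Notation in_annulus := (@in_annulus R N al be).
(* First, second and third derivatives of u. The first index of dd and of ddd is
   that of the derivative taken last. *)
Variables (d : 'I_N -> V -> R) (dd : 'I_N -> 'I_N -> V -> R)
  (ddd : 'I_N -> 'I_N -> 'I_N -> V -> R).
Hypothesis dC : forall j, C1 (d j) (fun i => dd i j).
Hypothesis ddC : forall j k, C1 (dd j k) (fun i => ddd i j k).
Hypothesis ddS : forall i j, dd i j = dd j i.
Hypothesis dddS : forall i j k, ddd i j k = ddd j i k.
Hypothesis d0 : forall i x, ~ annulus x -> d i x = 0.
Hypothesis dd0 : forall i j x, ~ annulus x -> dd i j x = 0.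

Lemma dddSr i j k : ddd i j k = ddd i k j.
Proof.
apply/funext => x; have [_ /(_ i)[/(_ x)[_ <-] _]] := ddC j k.
by have [_ /(_ i)[/(_ x)[_ <-] _]] := ddC k j; rewrite ddS.
Qed.

(** In terms of $r = |x|$ and $\partial_r$, the next quantities are
$x \cdot \nabla u = r \partial_r u$, the components of
$r \partial_r \nabla u$, those of $\frac12 \nabla |\nabla u|^2$ and those of
$r \partial_r$ applied to the Hessian; then $|\nabla u|^2$,
$r^2 \partial_r^2 u$, $r^2 |\partial_r \nabla u|^2$ and
$\frac{r}{2} \partial_r |\nabla u|^2$. *)
Definition rad_d (x : V) := \sum_j x 0 j * d j x.
Definition rad_dd i (x : V) := \sum_j x 0 j * dd i j x.
Definition grad_dd i (x : V) := \sum_j d j x * dd i j x.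
Definition rad_ddd i k (x : V) := \sum_j x 0 j * ddd i k j x.
Definition grad_sqr (x : V) := \sum_j d j x * d j x.
Definition rad_rad (x : V) := \sum_i x 0 i * rad_dd i x.
Definition rad_dd_sqr (x : V) := \sum_i rad_dd i x * rad_dd i x.
Definition rad_grad (x : V) := \sum_i d i x * rad_dd i x.
Definition lap (x : V) := \sum_i dd i i x.
Definition hess_sqr (x : V) := \sum_i \sum_j dd i j x * dd i j x.
Definition dlap i (x : V) := \sum_k ddd i k k x.
Definition sqr_norm (x : V) := \sum_i x 0 i * x 0 i.

Lemma sqr_normE x : sqr_norm x = enorm x ^+ 2.
Proof. by rewrite enorm_sqr; apply: eq_bigr => i _; rewrite expr2. Qed.

Lemma sum_kronecker (F : 'I_N -> R) i : \sum_j (j == i)%:R * F j = F i.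
Proof.
by rewrite (bigD1 i)//= eqxx mul1r big1 ?addr0// => j /negPf->; rewrite mul0r.
Qed.

Lemma C1_rad_d : C1 rad_d (fun i x => d i x + rad_dd i x).
Proof.
apply: (C1_eq (C1_sum (fun j => C1M (@C1_coord R N j) (dC j)))) => i x.
by rewrite big_split/= sum_kronecker.
Qed.

Lemma C1_rad_dd k : C1 (rad_dd k) (fun i x => dd k i x + rad_ddd i k x).
Proof.
apply: (C1_eq (C1_sum (fun j => C1M (@C1_coord R N j) (ddC k j)))) => i x.
by rewrite big_split/= (sum_kronecker (fun j => dd k j x)).
Qed.

Lemma C1_grad_sqr : C1 grad_sqr (fun i x => 2 * grad_dd i x).
Proof.
apply: (C1_eq (C1_sum (fun j => C1M (dC j) (dC j)))) => i x.
by rewrite mulr_sumr; apply: eq_bigr => j _; ring.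
Qed.

Lemma C1_lap : C1 lap dlap.
Proof. exact: C1_sum. Qed.

Lemma C1_grad_dd k : C1 (grad_dd k)
  (fun i x => \sum_j (dd i j x * dd k j x + d j x * ddd i k j x)).
Proof. exact: (C1_sum (fun j => C1M (dC j) (ddC k j))). Qed.

Lemma rad_grad_dd (x : V) : \sum_i x 0 i * grad_dd i x = rad_grad x.
Proof.
under eq_bigr do rewrite mulr_sumr; rewrite exchange_big/=.
apply: eq_bigr => j _; rewrite mulr_sumr; apply: eq_bigr => i _.
by rewrite ddS; ring.
Qed.

Lemma dlapE j : dlap j = fun x => \sum_i ddd i i j x.
Proof.
by apply/funext => x; apply: eq_bigr => i _; rewrite dddS dddSr.
Qed.

Lemma rad_d0 x : ~ annulus x -> rad_d x = 0.
Proof. by move=> xA; rewrite /rad_d big1// => i _; rewrite d0// mulr0. Qed.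

Lemma rad_dd0 i x : ~ annulus x -> rad_dd i x = 0.
Proof. by move=> xA; rewrite /rad_dd big1// => j _; rewrite dd0// mulr0. Qed.

Lemma in_annulus_d i : in_annulus (d i).
Proof. by split=> [x _|x]; [exact: (dC i).1|exact: d0]. Qed.

Lemma in_annulus_dd i j : in_annulus (dd i j).
Proof. by split=> [x _|x]; [exact: (ddC i j).1|exact: dd0]. Qed.

Lemma in_annulus_rad_d : in_annulus rad_d.
Proof. by split=> [x _|x]; [exact: C1_rad_d.1|exact: rad_d0]. Qed.

Lemma in_annulus_rad_dd i : in_annulus (rad_dd i).
Proof. by split=> [x _|x]; [exact: (C1_rad_dd i).1|exact: rad_dd0]. Qed.

Lemma in_annulus_grad_sqr : in_annulus grad_sqr.
Proof.
by apply: in_annulus_sum => i; apply: in_annulusM; exact: in_annulus_d.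
Qed.

Lemma in_annulus_rad_rad : in_annulus rad_rad.
Proof.
apply: in_annulus_sum => i; apply: in_annulusMl; last exact: in_annulus_rad_dd.
by move=> x _; exact: coord_continuous.
Qed.

Lemma in_annulus_rad_dd_sqr : in_annulus rad_dd_sqr.
Proof.
by apply: in_annulus_sum => i; apply: in_annulusM; exact: in_annulus_rad_dd.
Qed.

Lemma in_annulus_rad_grad : in_annulus rad_grad.
Proof.
apply: in_annulus_sum => i; apply: in_annulusM; first exact: in_annulus_d.
exact: in_annulus_rad_dd.
Qed.

Lemma in_annulus_lap : in_annulus lap.
Proof. by apply: in_annulus_sum => i; exact: in_annulus_dd. Qed.

Lemma in_annulus_hess_sqr : in_annulus hess_sqr.
Proof.
apply: (in_annulus_sum (f := fun i x => \sum_j dd i j x * dd i j x)) => i.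
by apply: in_annulus_sum => j; apply: in_annulusM; exact: in_annulus_dd.
Qed.

(** Each identity of this part integrates the divergence of the named field times
$a(|x|)$. The third derivatives of $u$ that occur in [null_grad_lap] and
[null_rad_d_rad_dd] cancel, by symmetry. *)
Section weights.
Variables (a a' : R -> R).
Hypothesis da : forall r, al <= r <= be -> is_derive r 1 a (a' r).
Hypothesis ca' : forall r, al <= r <= be -> {for r, continuous a'}.

(** The field $|\nabla u|^2 x$. *)
Lemma null_x_grad_sqr : integral_null (fun x =>
  a' (enorm x) / enorm x * (enorm x ^+ 2 * grad_sqr x) +
  a (enorm x) * (N%:R * grad_sqr x + 2 * rad_grad x)).
Proof.
have := divergence_radial al0 (Y := fun i x => x 0 i * grad_sqr x) da ca'
  (fun i => C1M (@C1_coord R N i) C1_grad_sqr).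
move=> H; apply: (integral_null_ext (H _)) => [i x xA|x];
  first by rewrite in_annulus_grad_sqr.2// mulr0.
apply/esym; congr (_ * _ + _ * _).
  by rewrite -sqr_normE mulr_suml; apply: eq_bigr => i _; ring.
rewrite big_split/=; congr (_ + _).
  under [RHS]eq_bigr do rewrite eqxx mul1r.
  by rewrite sumr_const card_ord mulr_natl.
by rewrite -rad_grad_dd mulr_sumr; apply: eq_bigr => i _; ring.
Qed.

(** The field $(x \cdot \nabla u)^2 x$. *)
Lemma null_x_rad_d_sqr : integral_null (fun x =>
  a' (enorm x) / enorm x * (enorm x ^+ 2 * (rad_d x * rad_d x)) +
  a (enorm x) * (N%:R * (rad_d x * rad_d x) +
                 2 * (rad_d x * (rad_d x + rad_rad x)))).
Proof.
have := divergence_radial al0 (Y := fun i x => x 0 i * (rad_d x * rad_d x)) da ca'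
  (fun i => C1M (@C1_coord R N i) (C1M C1_rad_d C1_rad_d)).
move=> H; apply: (integral_null_ext (H _)) => [i x xA|x];
  first by rewrite rad_d0// mul0r mulr0.
apply/esym; congr (_ * _ + _ * _).
  by rewrite -sqr_normE mulr_suml; apply: eq_bigr => i _; ring.
rewrite big_split/=; congr (_ + _).
  under [RHS]eq_bigr do rewrite eqxx mul1r.
  by rewrite sumr_const card_ord mulr_natl.
rewrite {2}/rad_d /rad_rad -big_split/= mulrA mulr_sumr.
by apply: eq_bigr => i _; ring.
Qed.

(** The field $\Delta u \nabla u - \frac12 \nabla |\nabla u|^2$. *)
Lemma null_grad_lap : integral_null (fun x =>
  a' (enorm x) / enorm x * (rad_d x * lap x - rad_grad x) +
  a (enorm x) * (lap x * lap x - hess_sqr x)).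
Proof.
have := divergence_radial al0 (Y := fun i x => d i x * lap x - grad_dd i x) da ca'
  (fun i => C1B (C1M (dC i) C1_lap) (C1_grad_dd i)).
move=> H; apply: (integral_null_ext (H _)) => [i x xA|x].
  by rewrite d0// mul0r sub0r /grad_dd big1 ?oppr0// => j _; rewrite d0// mul0r.
apply/esym; congr (_ * _ + _ * _).
  rewrite -rad_grad_dd /rad_d mulr_suml -sumrB.
  by apply: eq_bigr => i _; ring.
have -> : lap x * lap x - hess_sqr x = \sum_i (dd i i x * lap x + d i x * dlap i x
   - (\sum_j dd i j x * dd i j x) - d i x * dlap i x).
  by rewrite /lap /hess_sqr mulr_suml -sumrB; apply: eq_bigr => i _; ring.
rewrite [in LHS]sumrB [in RHS]sumrB; apply/eqP.
have -> : \sum_i d i x * dlap i x = \sum_i \sum_j d j x * ddd i i j x.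
  rewrite exchange_big/=; apply: eq_bigr => j _.
  by rewrite dlapE -mulr_sumr.
apply/eqP; rewrite [in LHS]sumrB -addrA -opprD -big_split/=; congr (_ - _).
by apply: eq_bigr => i _; rewrite -big_split.
Qed.

(** The field $(x \cdot \nabla u) \nabla u$. *)
Lemma null_rad_d_grad : integral_null (fun x =>
  a' (enorm x) / enorm x * (rad_d x * rad_d x) +
  a (enorm x) * (grad_sqr x + rad_grad x + rad_d x * lap x)).
Proof.
have := divergence_radial al0 (Y := fun i x => rad_d x * d i x) da ca'
  (fun i => C1M C1_rad_d (dC i)).
move=> H; apply: (integral_null_ext (H _)) => [i x xA|x]; first by rewrite d0// mulr0.
apply/esym; congr (_ * _ + _ * _).
  by rewrite {1}/rad_d mulr_suml; apply: eq_bigr => i _; ring.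
rewrite /grad_sqr /rad_grad /lap mulr_sumr -!big_split/=.
by apply: eq_bigr => i _; ring.
Qed.

(** The field $(x \cdot \nabla u) (D^2u\, x - \Delta u\, x)$. *)
Lemma null_rad_d_rad_dd : integral_null (fun x =>
  a' (enorm x) / enorm x * (rad_d x * (rad_rad x - enorm x ^+ 2 * lap x)) +
  a (enorm x) * (rad_grad x + rad_dd_sqr x - rad_rad x * lap x
                 - N%:R * (rad_d x * lap x))).
Proof.
have := divergence_radial al0 (Y := fun i x => rad_d x * (rad_dd i x - x 0 i *
  lap x)) da ca'
  (fun i => C1M C1_rad_d (C1B (C1_rad_dd i) (C1M (@C1_coord R N i) C1_lap))).
move=> H; apply: (integral_null_ext (H _)) => [i x xA|x]; first by rewrite rad_d0// mul0r.
apply/esym; congr (_ * _ + _ * _).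
  rewrite -sqr_normE /rad_rad /sqr_norm mulr_suml -sumrB mulr_sumr.
  by apply: eq_bigr => i _; ring.
have E : \sum_i rad_ddd i i x = \sum_i x 0 i * dlap i x.
  rewrite exchange_big/=; apply: eq_bigr => j _.
  by rewrite dlapE -mulr_sumr.
transitivity (\sum_i ((d i x * rad_dd i x + rad_dd i x * rad_dd i x
   - x 0 i * d i x * lap x - x 0 i * rad_dd i x * lap x
   + rad_d x * dd i i x - rad_d x * lap x)
   + rad_d x * (rad_ddd i i x - x 0 i * dlap i x))).
  rewrite big_split/= -mulr_sumr [X in _ + _ * X]sumrB E subrr mulr0 addr0.
  rewrite !(sumrB, big_split)/= sumr_const card_ord -mulr_natl.
  rewrite -/(rad_grad x) -/(rad_dd_sqr x) -!mulr_suml -/(rad_d x) -/(rad_rad x).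
  by rewrite -mulr_sumr -/(lap x); ring.
by apply: eq_bigr => i _; rewrite eqxx mul1r; ring.
Qed.

End weights.

(** * Pointwise inequalities *)

Lemma sum_sqr_comb (x : V) (a b c : R) :
  \sum_i (a * rad_dd i x + b * d i x + c * x 0 i) ^+ 2 =
  a ^+ 2 * rad_dd_sqr x + b ^+ 2 * grad_sqr x + c ^+ 2 * enorm x ^+ 2
  + (2 * a * b) * rad_grad x + (2 * a * c) * rad_rad x + (2 * b * c) * rad_d x.
Proof.
rewrite -sqr_normE /rad_dd_sqr /rad_grad /grad_sqr /rad_rad /rad_d /sqr_norm.
rewrite !mulr_sumr -!big_split/=; apply: eq_bigr => i _; ring.
Qed.

Lemma sum_sqr_comb_ge0 (x : V) (a b c : R) :
  0 <= a ^+ 2 * rad_dd_sqr x + b ^+ 2 * grad_sqr x + c ^+ 2 * enorm x ^+ 2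
  + (2 * a * b) * rad_grad x + (2 * a * c) * rad_rad x + (2 * b * c) * rad_d x.
Proof. by rewrite -sum_sqr_comb sumr_ge0// => i _; exact: sqr_ge0. Qed.

Lemma sum_sqr_hess (x : V) (k l c : R) :
  \sum_i \sum_j (dd i j x - k * (x 0 i * rad_dd j x + x 0 j * rad_dd i x)
     + l * (x 0 i * x 0 j) - c * (j == i)%:R) ^+ 2 =
  hess_sqr x - (4 * k) * rad_dd_sqr x + (2 * l) * rad_rad x - (2 * c) * lap x
  + (2 * k ^+ 2) * (enorm x ^+ 2 * rad_dd_sqr x + rad_rad x ^+ 2)
  - (4 * k * l) * (enorm x ^+ 2 * rad_rad x) + (4 * k * c) * rad_rad x
  + l ^+ 2 * enorm x ^+ 4 - (2 * c * l) * enorm x ^+ 2 + c ^+ 2 * N%:R.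
Proof.
pose q i := \sum_j rad_dd j x * dd i j x.
have qE : \sum_i x 0 i * q i = rad_dd_sqr x.
  under eq_bigr do rewrite mulr_sumr; rewrite exchange_big/=.
  apply: eq_bigr => j _; rewrite /rad_dd mulr_sumr; apply: eq_bigr => i _.
  by rewrite ddS; ring.
transitivity (\sum_i ((\sum_j dd i j x * dd i j x)
   - 2 * k * (x 0 i * q i + rad_dd i x * rad_dd i x)
   + 2 * l * (x 0 i * rad_dd i x) - 2 * c * dd i i x
   + k ^+ 2 * ((x 0 i * x 0 i) * rad_dd_sqr x + 2 * (x 0 i * rad_dd i x) * rad_rad x
       + (rad_dd i x * rad_dd i x) * sqr_norm x)
   - 2 * k * l * ((x 0 i * x 0 i) * rad_rad x + (x 0 i * rad_dd i x) * sqr_norm x)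
   + 4 * k * c * (x 0 i * rad_dd i x)
   + l ^+ 2 * ((x 0 i * x 0 i) * sqr_norm x) - 2 * c * l * (x 0 i * x 0 i) + c ^+ 2 * 1)).
  apply: eq_bigr => i _.
  transitivity (\sum_j (dd i j x * dd i j x
   - 2 * k * (x 0 i * (rad_dd j x * dd i j x) + rad_dd i x * (x 0 j * dd i j x))
   + 2 * l * (x 0 i * (x 0 j * dd i j x)) - 2 * c * ((j == i)%:R * dd i j x)
   + k ^+ 2 * ((x 0 i * x 0 i) * (rad_dd j x * rad_dd j x)
       + 2 * (x 0 i * rad_dd i x) * (x 0 j * rad_dd j x)
       + (rad_dd i x * rad_dd i x) * (x 0 j * x 0 j))
   - 2 * k * l * ((x 0 i * x 0 i) * (x 0 j * rad_dd j x)
       + (x 0 i * rad_dd i x) * (x 0 j * x 0 j))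
   + 2 * k * c * ((j == i)%:R * (x 0 i * rad_dd j x + rad_dd i x * x 0 j))
   + l ^+ 2 * ((x 0 i * x 0 i) * (x 0 j * x 0 j))
   - 2 * c * l * ((j == i)%:R * (x 0 i * x 0 j))
   + c ^+ 2 * ((j == i)%:R * 1))).
    apply: eq_bigr => j _; case: eqP => _ /=; ring.
  rewrite !(sumrB, big_split)/=.
  rewrite -!mulr_sumr !(big_split, sumrB)/= -!mulr_sumr !sum_kronecker.
  rewrite -/(q i) -/(rad_dd i x) -/(rad_dd_sqr x) -/(rad_rad x) -/(sqr_norm x).
  ring.
rewrite !(sumrB, big_split)/=.
rewrite -!mulr_sumr !(big_split, sumrB)/= -!mulr_suml -!mulr_sumr.
rewrite -/(rad_rad x) -/(sqr_norm x) -/(hess_sqr x) -/(rad_dd_sqr x) -/(lap x) qE.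
rewrite sumr_const card_ord sqr_normE.
ring.
Qed.

(** Cauchy-Schwarz for $x$ and $r \partial_r \nabla u + \nabla u$. *)
Lemma tangential_sqr_ge0 x : annulus x ->
  (rad_rad x + rad_d x) ^+ 2 / enorm x ^+ 2 <=
  rad_dd_sqr x + 2 * rad_grad x + grad_sqr x.
Proof.
move=> xA; have r0 := lt0r_neq0 (annulus_gt0 al0 xA).
rewrite -subr_ge0.
have := sum_sqr_comb_ge0 x 1 1 (- ((rad_rad x + rad_d x) / enorm x ^+ 2)).
congr (_ <= _); field; exact: r0.
Qed.

(** This is $|A|^2$ for $A = P (D^2 u) P - (\partial_r u / r) P$, with $P$ the
projection orthogonal to $x$: the projected Hessian, corrected by the second
fundamental form of the sphere through $x$. *)
Definition tangential_hess (x : V) : R :=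
  hess_sqr x - 2 * (rad_dd_sqr x / enorm x ^+ 2)
  + rad_rad x * rad_rad x / enorm x ^+ 4
  - 2 * (rad_d x / enorm x ^+ 2 * (lap x - rad_rad x / enorm x ^+ 2))
  + (N%:R - 1) * (rad_d x * rad_d x / enorm x ^+ 4).

Definition tangential_grad (x : V) : R :=
  grad_sqr x - rad_d x * rad_d x / enorm x ^+ 2.

Lemma in_annulus_tangential_hess : in_annulus tangential_hess.
Proof.
have pA := in_annulus_rad_d; have SA := in_annulus_rad_rad.
apply: in_annulusD.
  apply: in_annulusB.
    apply: in_annulusD.
      apply: in_annulusB; first exact: in_annulus_hess_sqr.
      by apply/in_annulusZ/in_annulus_divX/in_annulus_rad_dd_sqr.
    by apply: in_annulus_divX => //; apply: in_annulusM.
  apply/in_annulusZ/in_annulusM; first exact: in_annulus_divX.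
  by apply: in_annulusB; [exact: in_annulus_lap|exact: in_annulus_divX].
by apply/in_annulusZ/in_annulus_divX => //; exact: in_annulusM.
Qed.

Lemma in_annulus_tangential_grad : in_annulus tangential_grad.
Proof.
apply: in_annulusB; first exact: in_annulus_grad_sqr.
by apply: in_annulus_divX => //; apply: in_annulusM; exact: in_annulus_rad_d.
Qed.

Lemma tangential_grad_ge0 x : annulus x -> 0 <= tangential_grad x.
Proof.
move=> xA; have r0 := annulus_gt0 al0 xA.
have := sum_sqr_comb_ge0 x 0 1 (- (rad_d x / enorm x ^+ 2)).
congr (_ <= _); rewrite /tangential_grad; field; exact: lt0r_neq0.
Qed.

(** The left-hand side is the squared trace of $A$, a matrix of rank at most
$N - 1$; the bound is that $|B - c P|^2 \ge 0$ for $B = P (D^2 u) P$ and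
$c = \mathrm{tr} B / (N-1)$. *)
Lemma trace_tangential_hess x : annulus x -> (2 <= N)%N ->
  (lap x - rad_rad x / enorm x ^+ 2
     - (N%:R - 1) * (rad_d x / enorm x ^+ 2)) ^+ 2 <=
  (N%:R - 1) * tangential_hess x.
Proof.
move=> xA N2; have r0 := lt0r_neq0 (annulus_gt0 al0 xA).
have n0 : 0 < N%:R - 1 :> R by rewrite subr_gt0 ltr1n.
pose c := (lap x - rad_rad x / enorm x ^+ 2) / (N%:R - 1).
have : 0 <= (N%:R - 1) * (\sum_i \sum_j (dd i j x
     - (enorm x ^+ 2)^-1 * (x 0 i * rad_dd j x + x 0 j * rad_dd i x)
     + (rad_rad x / enorm x ^+ 4 + c / enorm x ^+ 2) * (x 0 i * x 0 j)
     - c * (j == i)%:R) ^+ 2).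
  by rewrite mulr_ge0 ?(ltW n0)//; do 2!apply: sumr_ge0 => ? _; exact: sqr_ge0.
rewrite sum_sqr_hess => H; rewrite -subr_ge0; move: H; congr (_ <= _).
rewrite /tangential_hess /c; field; rewrite r0 /=; exact: lt0r_neq0.
Qed.

(** * The gap on spheres *)

Section profile.
Variables (v v1 v2 : R -> R).
Hypothesis v_ge0 : forall r, al <= r <= be -> 0 <= v r.
Hypothesis dv : forall r, al <= r <= be -> is_derive r 1 v (v1 r).
Hypothesis dv1 : forall r, al <= r <= be -> is_derive r 1 v1 (v2 r).
Hypothesis cv2 : forall r, al <= r <= be -> {for r, continuous v2}.

Let cv r : al <= r <= be -> {for r, continuous v}.
Proof. by move=> /dv[/derivable1_diffP/differentiable_continuous]. Qed.

Let cv1 r : al <= r <= be -> {for r, continuous v1}.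
Proof. by move=> /dv1[/derivable1_diffP/differentiable_continuous]. Qed.

Let rgt0 r : al <= r <= be -> 0 < r.
Proof. by move=> /andP[+ _]; exact: lt_le_trans. Qed.

Let weight n r : al <= r <= be ->
  is_derive r 1 (fun r => v r / r ^+ n) (v1 r / r ^+ n - n%:R * v r / r ^+ n.+1).
Proof. by move=> rA; apply: is_derive_divX (dv rA); exact: rgt0. Qed.

Let weight1 n r : al <= r <= be ->
  is_derive r 1 (fun r => v1 r / r ^+ n) (v2 r / r ^+ n - n%:R * v1 r / r ^+ n.+1).
Proof. by move=> rA; apply: is_derive_divX (dv1 rA); exact: rgt0. Qed.

Let cweight n r : al <= r <= be ->
  {for r, continuous (fun r => v1 r / r ^+ n - n%:R * v r / r ^+ n.+1)}.
Proof.
move=> rA; apply: continuousB; apply: continuous_divX; rewrite ?rgt0//.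
- exact: cv1.
- by apply: continuousM; [exact: cst_continuous|exact: cv].
Qed.

Let cweight1 n r : al <= r <= be ->
  {for r, continuous (fun r => v2 r / r ^+ n - n%:R * v1 r / r ^+ n.+1)}.
Proof.
move=> rA; apply: continuousB; apply: continuous_divX; rewrite ?rgt0//.
- exact: cv2.
- by apply: continuousM; [exact: cst_continuous|exact: cv1].
Qed.

Definition sphere_gap (x : V) : R :=
  v (enorm x) * (tangential_hess x - tangential_grad x / enorm x ^+ 2).

Lemma in_annulus_sphere_gap : in_annulus sphere_gap.
Proof.
apply: in_annulus_radialM => //; apply: in_annulusB.
  exact: in_annulus_tangential_hess.
by apply: in_annulus_divX => //; exact: in_annulus_tangential_grad.
Qed.

(** Bochner on spheres: with a combination of divergences,
$\int V ((\mathrm{tr} A)^2 - |A|^2 - (N-2) T^2/r^2) = 0$. Adding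
$(N-1) |A|^2 \ge (\mathrm{tr} A)^2$ leaves $N - 2$ times the claim. *)
Lemma sphere_gap_dim_ge3 : (3 <= N)%N -> integral_pos al be sphere_gap.
Proof.
move=> N3.
have n0 : 0 < N%:R - 2 :> R by rewrite subr_gt0 ltr_nat.
have F2 := null_grad_lap (@weight 0%N) (@cweight 0%N).
have F4 := null_rad_d_rad_dd (@weight 2%N) (@cweight 2%N).
have F3 := null_rad_d_grad (@weight1 1%N) (@cweight1 1%N).
have P4 := null_x_rad_d_sqr (@weight1 3%N) (@cweight1 3%N).
have P5 := null_x_rad_d_sqr (@weight 4%N) (@cweight 4%N).
have F1 := null_x_grad_sqr (@weight 2%N) (@cweight 2%N).
have B := integral_nullD (integral_nullD (integral_nullD F2
  (integral_nullZ 2 F4)) (integral_nullD F3 (integral_nullZ (-1) P4)))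
  (integral_nullD (integral_nullZ N%:R P5) (integral_nullZ (-1) F1)).
have {}B := integral_nullW (integral_nullZ (N%:R - 2)^-1 B).
apply: integral_pos_le B in_annulus_sphere_gap _ => x xA.
have r0 := lt0r_neq0 (annulus_gt0 al0 xA).
have vx := v_ge0 xA.
have T := trace_tangential_hess xA (ltnW N3).
rewrite -subr_ge0.
have := mulr_ge0 (mulr_ge0 (ltW (etrans (invr_gt0 _) n0)) vx) (etrans (subr_ge0 _ _) T).
congr (_ <= _); rewrite /sphere_gap /tangential_hess /tangential_grad.
field; rewrite r0 lt0r_neq0//.
Qed.

Lemma sphere_gap_dim1 : N = 1%N -> integral_pos al be sphere_gap.
Proof.
move=> N1; have [i0 sE] := sum_ord1 R N1.
have rE (x : V) : enorm x ^+ 2 = x 0 i0 ^+ 2 by rewrite enorm_sqr sE.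
apply: (@integral_pos_le _ _ _ _ (fun=> 0) _ _ in_annulus_sphere_gap).
  split; last exact: Rintegral_ge0.
  by split=> // x _; exact: cst_continuous.
move=> x xA; rewrite le_eqVlt; apply/orP; left; apply/eqP.
have r0 : x 0 i0 != 0.
  by rewrite -sqrf_eq0 -rE sqrf_eq0 lt0r_neq0// (annulus_gt0 al0 xA).
have r4 : enorm x ^+ 4 = x 0 i0 ^+ 4 by rewrite !(exprM _ 2 2) rE.
rewrite /sphere_gap /tangential_hess /tangential_grad r4 !rE.
rewrite /hess_sqr /rad_dd_sqr /rad_rad /rad_dd /rad_d /lap /grad_sqr !sE.
have -> : N%:R = 1 :> R by rewrite N1.
by field.
Qed.

(** * The two halves of the inequality *)

(** The squared length of $\partial_r \nabla u - \nabla u / r$. *)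
Definition radial_defect_sqr (x : V) : R :=
  (rad_dd_sqr x - 2 * rad_grad x + grad_sqr x) / enorm x ^+ 2.

Lemma in_annulus_radial_defect_sqr : in_annulus radial_defect_sqr.
Proof.
apply: in_annulus_divX => //; apply: in_annulusD.
  apply: in_annulusB; first exact: in_annulus_rad_dd_sqr.
  exact/in_annulusZ/in_annulus_rad_grad.
exact: in_annulus_grad_sqr.
Qed.

Definition rellich_defect (x : V) : R :=
  v (enorm x) * (lap x * lap x) - v (enorm x) * radial_defect_sqr x
  + N%:R * (v1 (enorm x) / enorm x ^+ 1 * grad_sqr x).

Lemma in_annulus_rellich_defect : in_annulus rellich_defect.
Proof.
apply: in_annulusD.
  apply: in_annulusB; apply: in_annulus_radialM => //.
    by apply: in_annulusM; exact: in_annulus_lap.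
  exact: in_annulus_radial_defect_sqr.
apply: in_annulusZ; apply: (in_annulus_radialM (a := fun r => v1 r / r ^+ 1)).
  by move=> r rA; apply: continuous_divX; [exact: rgt0|exact: cv1].
exact: in_annulus_grad_sqr.
Qed.

(** The weights $V$, $V'/r$ and $V/r^2$ remove from the integrand the terms
$\Delta u\, \partial_r u$ and $\partial_r |\nabla u|^2$; what is left is a sum of
nonnegative terms and [sphere_gap]. *)
Lemma integral_rellich_defect :
  (forall r, al <= r <= be ->
     v2 r - 3%:R * (v1 r / r) - (N%:R - 5%:R) * (v r / r ^+ 2) <= 0) ->
  integral_pos al be sphere_gap -> integral_pos al be rellich_defect.
Proof.
move=> hv sg.
have F2 := null_grad_lap (@weight 0%N) (@cweight 0%N).
have F3 := null_rad_d_grad (@weight1 1%N) (@cweight1 1%N).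
have F3' := null_rad_d_grad (@weight 2%N) (@cweight 2%N).
have F1 := null_x_grad_sqr (@weight1 1%N) (@cweight1 1%N).
have F1' := null_x_grad_sqr (@weight 2%N) (@cweight 2%N).
have B := integral_nullD (integral_nullD F2 (integral_nullZ (-1) F3))
  (integral_nullD (integral_nullD F1 (integral_nullZ (-1) F1')) (integral_nullZ 2 F3')).
have {}B := integral_posD (integral_nullW B) sg.
apply: integral_pos_le B in_annulus_rellich_defect _ => // x xA.
have r0 := lt0r_neq0 (annulus_gt0 al0 xA).
have E2 := mulr_ge0 (v_ge0 xA) (etrans (subr_ge0 _ _) (tangential_sqr_ge0 xA)).
have {}E2 : 0 <= v (enorm x) * (rad_dd_sqr x + 2 * rad_grad x + grad_sqr x -
   (rad_rad x + rad_d x) ^+ 2 / enorm x ^+ 2) / enorm x ^+ 2.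
  by rewrite divr_ge0// sqr_ge0.
have T2 := mulr_ge0 (etrans (oppr_ge0 _) (hv _ xA)) (tangential_grad_ge0 xA).
rewrite -subr_ge0; have := addr_ge0 E2 T2; congr (_ <= _).
rewrite /rellich_defect /sphere_gap /tangential_hess /tangential_grad /radial_defect_sqr.
field; exact: r0.
Qed.

Section bessel.
Variables (q w : R -> R).
Hypothesis cw : forall r, al <= r <= be -> {for r, continuous w}.
Hypothesis dq : forall r, al <= r <= be -> derivable q r 1.
Hypothesis riccati : forall r e, al <= r <= be -> 0 < e ->
  'D_1 q r <= - (N%:R + 1) * (q r / r) - w r - N%:R * (v1 r / r) - q r ^+ 2 / (v r + e).

Let cq r : al <= r <= be -> {for r, continuous q}.
Proof. by move=> /dq/derivable1_diffP/differentiable_continuous. Qed.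

Definition bessel_defect (x : V) : R := v (enorm x) * radial_defect_sqr x
  - w (enorm x) * grad_sqr x - N%:R * (v1 (enorm x) / enorm x ^+ 1 * grad_sqr x).

Lemma in_annulus_bessel_defect : in_annulus bessel_defect.
Proof.
apply: in_annulusB; last first.
  apply: in_annulusZ; apply: (in_annulus_radialM (a := fun r => v1 r / r ^+ 1)).
    by move=> r rA; apply: continuous_divX; [exact: rgt0|exact: cv1].
  exact: in_annulus_grad_sqr.
apply: in_annulusB; apply: in_annulus_radialM => //.
  exact: in_annulus_radial_defect_sqr.
exact: in_annulus_grad_sqr.
Qed.

(** The one-sided divergence theorem for the field $(q/r) |\nabla u|^2 x$. The
integrand exceeds the bound of its divergence by the square of
$(V+\varepsilon) (\partial_r \nabla u - \nabla u / r) - q \nabla u$, divided by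
$V + \varepsilon$. *)
Lemma integral_bessel_defect_eps e : 0 < e ->
  integral_pos al be (fun x => bessel_defect x + e * radial_defect_sqr x).
Proof.
move=> e0.
pose b r := (- (N%:R + 1) * (q r / r ^+ 1) - w r - N%:R * (v1 r / r ^+ 1)
  - q r * q r / (v r + e)) / r ^+ 1 - q r / r ^+ 2.
have ve0 r : al <= r <= be -> 0 < v r + e.
  by move=> /v_ge0 v0; rewrite ltr_wpDl.
have cb r : al <= r <= be -> {for r, continuous b}.
  move=> rA; have rp := rgt0 rA.
  have cqr n : {for r, continuous (fun r => q r / r ^+ n)}.
    by apply: continuous_divX => //; exact: cq.
  have cvr n : {for r, continuous (fun r => v1 r / r ^+ n)}.
    by apply: continuous_divX => //; exact: cv1.
  apply: continuousB => //; apply: continuous_divX => //.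
  apply: continuousB; last first.
    apply: continuousM; first by apply: continuousM; exact: cq.
    apply: continuousV; first by rewrite lt0r_neq0// ve0.
    by apply: continuousD; [exact: cv|exact: cst_continuous].
  apply: continuousB.
    apply: continuousB; last exact: cw.
    by apply: continuousM; [exact: cst_continuous|exact: cqr].
  by apply: continuousM; [exact: cst_continuous|exact: cvr].
have da r : al <= r <= be ->
    is_derive r 1 (fun r => q r / r ^+ 1) ('D_1 q r / r ^+ 1 - 1%:R * q r / r ^+ 2).
  by move=> rA; apply: is_derive_divX; [exact: rgt0|exact/derivableP/dq].
have F : integral_pos al be (fun x =>
    b (enorm x) / enorm x * (\sum_i x 0 i * (x 0 i * grad_sqr x)) +
    q (enorm x) / enorm x ^+ 1 * (\sum_i
      ((i == i)%:R * grad_sqr x + x 0 i * (2 * grad_dd i x)))).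
  apply: (divergence_radial_le al0 (a := fun r => q r / r ^+ 1)
    (Y := fun i x => x 0 i * grad_sqr x) _ cb
    (fun i => C1M (@C1_coord R N i) C1_grad_sqr)).
  - by move=> r /da[].
  - by move=> i x xA; rewrite in_annulus_grad_sqr.2// mulr0.
  - move=> i x xA; apply: ler_wpM2r.
      by rewrite mulrA mulr_ge0 ?sqr_ge0// sumr_ge0// => j _; exact: sqr_ge0.
    have [_ ->] := da _ xA; rewrite /b mul1r lerD2r.
    rewrite ler_pM2r ?invr_gt0 ?exprn_gt0 ?rgt0//.
    by have := riccati xA e0; rewrite !expr1 -!expr2.
apply: (integral_pos_le F).
  apply: in_annulusD; first exact: in_annulus_bessel_defect.
  exact/in_annulusZ/in_annulus_radial_defect_sqr.
move=> x xA; have r0 := lt0r_neq0 (annulus_gt0 al0 xA).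
have vp := ve0 _ xA.
have -> : \sum_i x 0 i * (x 0 i * grad_sqr x) = enorm x ^+ 2 * grad_sqr x.
  by rewrite -sqr_normE mulr_suml; apply: eq_bigr => i _; ring.
have -> : \sum_i ((i == i)%:R * grad_sqr x + x 0 i * (2 * grad_dd i x)) =
    N%:R * grad_sqr x + 2 * rad_grad x.
  rewrite big_split/=; congr (_ + _).
    under eq_bigr do rewrite eqxx mul1r.
    by rewrite sumr_const card_ord mulr_natl.
  by rewrite -rad_grad_dd mulr_sumr; apply: eq_bigr => i _; ring.
have S := sum_sqr_comb_ge0 x ((v (enorm x) + e) / enorm x)
  (- ((v (enorm x) + e) / enorm x + q (enorm x))) 0.
rewrite -subr_ge0.
have := divr_ge0 S (ltW vp); congr (_ <= _).
rewrite /bessel_defect /radial_defect_sqr /b; field.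
by rewrite r0 lt0r_neq0.
Qed.

Lemma integral_bessel_defect : integral_pos al be bessel_defect.
Proof.
have dA := in_annulus_bessel_defect; have hA := in_annulus_radial_defect_sqr.
split=> //; apply/ler_addgt0Pr => e e0.
pose I := integral_tuple radial_defect_sqr.
have I0 : 0 < `|I| + 1 by rewrite ltr_wpDl.
have e10 : 0 < e / (`|I| + 1) by rewrite divr_gt0.
have [_] := integral_bessel_defect_eps e10.
rewrite (integral_tupleD dA (in_annulusZ _ hA)) (integral_tupleZ _ hA).
move=> /le_trans; apply; rewrite lerD2l -/I.
rewrite mulrAC ler_pdivrMr// ler_pM2l//.
by rewrite (le_trans (ler_norm _))// lerDl.
Qed.

Lemma integral_rellich_bessel :
  (forall r, al <= r <= be ->
     v2 r - 3%:R * (v1 r / r) - (N%:R - 5%:R) * (v r / r ^+ 2) <= 0) ->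
  integral_pos al be sphere_gap ->
  integral_pos al be (fun x =>
    v (enorm x) * (lap x * lap x) - w (enorm x) * grad_sqr x).
Proof.
move=> hv sg.
have -> : (fun x => v (enorm x) * (lap x * lap x) - w (enorm x) * grad_sqr x) =
    (fun x => rellich_defect x + bessel_defect x).
  by apply/funext => x; rewrite /rellich_defect /bessel_defect; ring.
exact: integral_posD (integral_rellich_defect hv sg) integral_bessel_defect.
Qed.

End bessel.
End profile.
End fields.

(** * The Wirtinger inequality *)

Section wirtinger.
Context {R : realType}.
Local Notation mu := (@lebesgue_measure R).

Lemma derive1_ge0_le (P P' : R -> R) (a b : R) : a <= b ->
  (forall s : R, a <= s <= b -> is_derive s 1 P (P' s)) ->
  (forall s : R, a <= s <= b -> 0 <= P' s) -> P a <= P b.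
Proof.
move=> ab dP P0.
apply: (@ger0_derive1_ndecr R P a b) => //.
- by move=> s; rewrite in_itv/= => /andP[/ltW ? /ltW ?]; case: (dP s);
    rewrite ?s0//; apply/andP.
- move=> s; rewrite in_itv/= => /andP[/ltW sa /ltW sb].
  have sab : a <= s <= b by rewrite sa.
  by rewrite derive1E; case: (dP s sab) => _ ->; exact: P0.
- by apply: derivable_within_continuous => s; rewrite in_itv/= => /dP[].
Qed.

(** For $\lambda < 1$ the function $\tau(s) = \lambda \tan (\lambda (s - m))$ is
smooth on the closed interval and $\tau' = \lambda^2 + \tau^2$, so that
$F'^2 - \lambda^2 F^2 = (F' + \tau F)^2 - (\tau F^2)'$; the boundary terms
vanish, and $\lambda$ tends to 1. *)
Lemma wirtinger_dirichlet (P F F' : R -> R) (m : R) :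
  (forall s : R, m - pi / 2 <= s <= m + pi / 2 ->
     is_derive s 1 P (F' s ^+ 2 - F s ^+ 2)) ->
  (forall s : R, is_derive s 1 F (F' s)) ->
  F (m - pi / 2) = 0 -> F (m + pi / 2) = 0 ->
  P (m - pi / 2) <= P (m + pi / 2).
Proof.
move=> dP dF Fa Fb; set a := m - pi / 2; set b := m + pi / 2.
have pi0 : 0 < pi / 2 :> R by rewrite divr_gt0// pi_gt0.
have ab : a <= b by rewrite /a /b; lra.
have cF2 : {within `[a, b], continuous (fun s => F s ^+ 2)}.
  apply: derivable_within_continuous => s _.
  by have [] := is_deriveX 2 (dF s).
have [c _ Bc] := EVT_max ab cF2.
set B := F c ^+ 2 in Bc.
have key l : 0 < l < 1 -> P a <= P b + (1 - l ^+ 2) * (B * (b - a)).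
  move=> /andP[l0 l1].
  pose T s := l * tan (l * (s - m)).
  pose Q s := P s + T s * F s ^+ 2 + (1 - l ^+ 2) * B * s.
  have cosl s : a <= s <= b -> cos (l * (s - m)) != 0.
    move=> /andP[sa sb]; rewrite gt_eqF// cos_gt0_pihalf//.
    rewrite -ltr_norml; have [->|sm] := eqVneq (s - m) 0.
      by rewrite mulr0 normr0.
    rewrite normrM gtr0_norm// (@lt_le_trans _ _ (1 * `|s - m|))//.
      by rewrite ltr_pM2r// normr_gt0.
    by rewrite mul1r ler_norml; apply/andP; split; rewrite /a /b in sa sb; lra.
  have dT s : a <= s <= b -> is_derive s 1 T (l ^+ 2 + T s ^+ 2).
    move=> sab; have dl : is_derive s 1 (fun s => l * (s - m)) l.
      apply: (is_derive_eq (is_deriveZ l (is_deriveB (is_derive_id s 1)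
        (is_derive_cst m s 1)))).
      by rewrite subr0 [_ *: _]mulr1.
    have dt := @is_derive1_comp R tan (fun s : R => l * (s - m)) s _ _
      (is_derive_tan (cosl s sab)) dl.
    rewrite /T; apply: (is_derive_eq (is_deriveZ l dt)).
    by rewrite cos2_tan2 ?cosl// /T /GRing.scale/=; ring.
  have dQ s : a <= s <= b ->
      is_derive s 1 Q ((F' s + T s * F s) ^+ 2 + (1 - l ^+ 2) * (B - F s ^+ 2)).
    move=> sab; rewrite /Q; apply: (is_derive_eq (is_deriveD (is_deriveD (dP s sab)
      (is_deriveM (dT s sab) (is_deriveX 2 (dF s))))
      (is_deriveZ ((1 - l ^+ 2) * B) (is_derive_id s 1)))).
    rewrite /GRing.scale/= !fctE; ring.
  have l2 : 0 <= 1 - l ^+ 2 by rewrite subr_ge0 expr_le1// ltW.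
  have : Q a <= Q b.
    apply: derive1_ge0_le ab dQ _ => s sab.
    rewrite addr_ge0 ?sqr_ge0// mulr_ge0// subr_ge0; apply: Bc.
    by rewrite in_itv.
  by rewrite /Q Fa Fb expr0n/= !mulr0 !addr0; lra.
apply/ler_addgt0Pr => e e0.
pose K := B * (b - a).
have K0 : 0 <= K by rewrite mulr_ge0 ?sqr_ge0// subr_ge0.
(* For l = 1 - t the error (1 - l ^ 2) K is at most 2 t K. *)
pose t := Num.min (2^-1) (e / (2 * (K + 1))).
have t0 : 0 < t by rewrite lt_min invr_gt0 ltr0n divr_gt0// mulr_gt0// ltr_wpDl.
have t1 : t <= 2^-1 by rewrite ge_min lexx.
have t2 : t <= e / (2 * (K + 1)) by rewrite ge_min lexx orbT.
have /key/le_trans : 0 < 1 - t < 1 by apply/andP; split; lra.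
apply; rewrite lerD2l -/K.
rewrite ler_pdivlMr in t2; last by rewrite mulr_gt0// ltr_wpDl.
nra.
Qed.

(** A function $f$ with period $2 \pi$ takes the same value $c$ at two opposite
points $t_0$ and $t_0 + \pi$. The Dirichlet case applies to $f - c$ on the two
half-periods, and $\int (f - c)^2 \ge \int f^2$ over a period because $f$ has a
periodic primitive $U$. *)
Lemma wirtinger (U f f' : R -> R) :
  (forall s : R, is_derive s 1 U (f s)) -> (forall s : R, is_derive s 1 f (f' s)) ->
  continuous f' -> (forall s : R, U (s + pi *+ 2) = U s) ->
  0 <= \int[mu]_(s in `[0, pi *+ 2]) (f' s ^+ 2 - f s ^+ 2).
Proof.
move=> dU df cf' Uper.
have pi0 : 0 < pi :> R := pi_gt0 R.
have cf : continuous f.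
  by move=> s; have [/derivable1_diffP/differentiable_continuous] := df s.
have shift (g : R -> R) s dg : is_derive (s + pi *+ 2) 1 g dg -> is_derive s 1
  (fun s => g (s + pi *+ 2)) dg.
  move=> dg1.
  have ds : is_derive s 1 (fun s => s + pi *+ 2) 1.
    apply: (is_derive_eq (is_deriveD (is_derive_id s 1) (is_derive_cst (pi *+ 2) s 1))).
    by rewrite addr0.
  have dgs := @is_derive1_comp R g (fun s : R => s + pi *+ 2) s _ _ dg1 ds.
  by apply: (is_derive_eq dgs); rewrite mulr1.
have fper s : f (s + pi *+ 2) = f s.
  have [_ <-] := dU s; have [_ <-] := shift _ _ _ (dU (s + pi *+ 2)).
  by congr ('D_1 _ s); apply/funext => t; rewrite Uper.
have f'per s : f' (s + pi *+ 2) = f' s.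
  have [_ <-] := df s; have [_ <-] := shift _ _ _ (df (s + pi *+ 2)).
  by congr ('D_1 _ s); apply/funext => t; rewrite fper.
pose G s := f' s ^+ 2 - f s ^+ 2.
have cG : continuous G.
  move=> s; apply: (@continuousB _ _ _ (fun s => f' s ^+ 2) (fun s => f s ^+ 2)).
    by apply: (continuous_comp (f := f') (g := fun y => y ^+ 2));
      [exact: cf'|exact: exprn_continuous].
  by apply: (continuous_comp (f := f) (g := fun y => y ^+ 2));
    [exact: cf|exact: exprn_continuous].
pose P s := \int[mu]_(t in `[- 1, s]) G t.
have dP s : - 1 < s < 4 * pi -> is_derive s 1 P (G s).
  move=> /andP[s1 s2].
  have [||GD GE] := @continuous_FTC1_closed R G (- 1) s (4 * pi) s2 _ s1.
  - exact: integrable_continuous_segment.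
  - exact: cG.
  by split; [exact: GD|rewrite -derive1E; exact: GE].
have intE : \int[mu]_(s in `[0, pi *+ 2]) G s = P (pi *+ 2) - P 0.
  rewrite /Rintegral (@continuous_FTC2 _ G P 0 (pi *+ 2)).
  - by [].
  - by rewrite mulrn_wgt0.
  - exact: continuous_subspaceT.
  - split; [|apply: cvg_at_right_filter|apply: cvg_at_left_filter].
    + move=> s; rewrite in_itv/= => /andP[s0 s1]; have [] // := dP s.
      by apply/andP; split; lra.
    + have [|/derivable1_diffP/differentiable_continuous] := dP 0; last exact.
      by apply/andP; split; lra.
    + have [|/derivable1_diffP/differentiable_continuous] := dP (pi *+ 2); last exact.
      by apply/andP; split; lra.
  - move=> s; rewrite in_itv/= => /andP[s0 s1]; rewrite derive1E.
    have [|] // := dP s; by apply/andP; split; lra.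
rewrite intE.
have [t0 t0pi ft0] : exists2 t, 0 <= t <= pi & f t = f (t + pi).
  pose g t := f t - f (t + pi).
  have cg : {within `[0, pi], continuous g}.
    apply: continuous_subspaceT => t; apply: continuousB; first exact: cf.
    apply: (continuous_comp (f := fun t => t + pi) (g := f)); last exact: cf.
    by apply: continuousD; [exact: cvg_id|exact: cst_continuous].
  have gpi : g pi = - g 0.
    by rewrite /g -mulr2n -(add0r (pi *+ 2)) fper add0r opprB.
  have [|t] := @IVT R g 0 pi 0 (ltW pi0) cg.
    rewrite gpi ge_min le_max oppr_le0 oppr_ge0.
    by case: (leP (g 0) 0) => /= g0; rewrite ?orbT ?(ltW g0).
  by rewrite in_itv/= => tpi /eqP; rewrite subr_eq0 => /eqP ft; exists t.
have Pshift s : 0 <= s <= pi -> P (s + pi *+ 2) - P s = P (pi *+ 2) - P 0.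
  move=> /andP[s0 spi].
  have dD t : 0 <= t <= s -> is_derive t 1 (fun t => P (t + pi *+ 2) - P t) 0.
    move=> /andP[t0' ts].
    have d1 : is_derive (t + pi *+ 2) 1 P (G (t + pi *+ 2)).
      by apply: dP; apply/andP; split; lra.
    have d2 : is_derive t 1 P (G t) by apply: dP; apply/andP; split; lra.
    apply: (is_derive_eq (is_deriveB (shift _ _ _ d1) d2)).
    by rewrite /G fper f'per subrr.
  apply/eqP; rewrite eq_le; apply/andP; split.
    rewrite -lerN2 -{1}(add0r (pi *+ 2)).
    apply: (derive1_ge0_le (P := fun t => - (P (t + pi *+ 2) - P t)) (P' :=
      fun=> 0) s0) => // t /dD dt.
    by apply: (is_derive_eq (is_deriveN dt)); rewrite oppr0.
  rewrite -{1}(add0r (pi *+ 2)).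
  by apply: (derive1_ge0_le (P := fun t => P (t + pi *+ 2) - P t) (P' := fun=>
    0) s0 dD) => t _.
rewrite -(Pshift t0)//; case/andP : t0pi => t00 t0p.
pose c := f t0.
(* H is a primitive of f' ^ 2 - (f - c) ^ 2. *)
pose H s := P s + 2 * c * U s - c ^+ 2 * s.
have dF (s : R) : is_derive s 1 (fun s => f s - c) (f' s).
  apply: (is_derive_eq (is_deriveB (df s) (is_derive_cst c s 1))).
  by rewrite subr0.
have dH s : - 1 < s < 4 * pi ->
    is_derive s 1 H (f' s ^+ 2 - (f s - c) ^+ 2).
  move=> sA; apply: (is_derive_eq (is_deriveB (is_deriveD (dP s sA)
    (is_deriveZ (2 * c) (dU s))) (is_deriveZ (c ^+ 2) (is_derive_id s 1)))).
  by rewrite /G /GRing.scale/=; ring.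
have half m : t0 + pi / 2 <= m <= t0 + pi + pi / 2 -> f (m - pi / 2) = c -> f
  (m + pi / 2) = c ->
    H (m - pi / 2) <= H (m + pi / 2).
  move=> /andP[m1 m2] fa fb; have W := @wirtinger_dirichlet H (fun s : R => f s - c) f' m.
  apply: W => //.
  - move=> s /andP[s1 s2]; apply: dH; apply/andP; split; lra.
  - by rewrite fa subrr.
  - by rewrite fb subrr.
have h1 : H t0 <= H (t0 + pi).
  have e1 : t0 + pi / 2 - pi / 2 = t0 by lra.
  have e2 : t0 + pi / 2 + pi / 2 = t0 + pi by lra.
  have := half (t0 + pi / 2); rewrite e1 e2; apply => //.
  by apply/andP; split; lra.
have h2 : H (t0 + pi) <= H (t0 + pi *+ 2).
  have e1 : t0 + pi + pi / 2 - pi / 2 = t0 + pi by lra.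
  have e2 : t0 + pi + pi / 2 + pi / 2 = t0 + pi *+ 2 by lra.
  have := half (t0 + pi + pi / 2); rewrite e1 e2 fper; apply => //.
  by apply/andP; split; lra.
have c2 : 0 <= c ^+ 2 * (pi *+ 2).
  by rewrite mulr_ge0 ?sqr_ge0// mulrn_wge0// ltW.
by have := le_trans h1 h2; rewrite /H Uper mulrDr; lra.
Qed.

End wirtinger.

(** * Rotations of the plane *)

Section plane.
Context {R : realType}.
Local Notation mu := (@lebesgue_measure R).
Local Notation i0 := (ord0 : 'I_2).
Local Notation i1 := (lift ord0 ord0 : 'I_2).
Implicit Types (x : 'rV[R]_2) (g : 'rV[R]_2 -> R).

Definition vec2 (a b : R) : 'rV[R]_2 := \row_i (if i == i0 then a else b).

Lemma vec2_0 a b : vec2 a b 0 i0 = a. Proof. by rewrite mxE. Qed.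

Lemma vec2_1 a b : vec2 a b 0 i1 = b. Proof. by rewrite mxE. Qed.

Lemma vec2E x : vec2 (x 0 i0) (x 0 i1) = x.
Proof.
apply/rowP => i; have [j ->|->] := unliftP ord0 i; last by rewrite vec2_0.
by rewrite (ord1 j) vec2_1.
Qed.

Lemma vec2_line0 a b (h : R) : vec2 (h + a) b = h *: delta_mx 0 i0 + vec2 a b.
Proof.
apply/rowP => i; have [j ->|->] := unliftP ord0 i.
  by rewrite [RHS]mxE (ord1 j) !vec2_1 !mxE/= mulr0 add0r.
by rewrite [RHS]mxE !vec2_0 !mxE/= mulr1.
Qed.

Lemma vec2_line1 a b (h : R) : vec2 a (h + b) = h *: delta_mx 0 i1 + vec2 a b.
Proof.
apply/rowP => i; have [j ->|->] := unliftP ord0 i.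
  by rewrite [RHS]mxE (ord1 j) !vec2_1 !mxE/= mulr1.
by rewrite [RHS]mxE !vec2_0 !mxE/= mulr0 add0r.
Qed.

Lemma vec2_cvg (T : topologicalType) (F : set_system T) {FF : Filter F}
    (f g : T -> R) a b :
  f @ F --> a -> g @ F --> b -> (fun t => vec2 (f t) (g t)) @ F --> vec2 a b.
Proof.
move=> fa gb A /nbhs_ballP[e /= e0 eA].
have Ha := fa _ (nbhsx_ballx a e e0); have Hb := gb _ (nbhsx_ballx b e e0).
have H : F [set t | ball a e (f t) /\ ball b e (g t)] by apply: filterI.
apply: (@filterS _ F _ _ _ _ H) => t [ta tb]; apply: eA; split => // k i.
by rewrite !mxE; case: ifP.
Qed.

(** Split the increment into a horizontal and a vertical part. The horizontal part
is controlled by the mean value theorem and by the continuity of the first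
partial derivative, the vertical one by the one-variable chain rule. *)
Lemma is_derive_curve g dg (p q : R -> R) (t p' q' : R) : C1 g dg ->
  is_derive t 1 p p' -> is_derive t 1 q q' ->
  is_derive t 1 (fun s => g (vec2 (p s) (q s)))
    (dg i0 (vec2 (p t) (q t)) * p' + dg i1 (vec2 (p t) (q t)) * q').
Proof.
move=> [cg gC] dp dq; have [d0 c0] := gC i0; have [d1 c1] := gC i1.
have [P [pE cP Pt]] := (is_derive1_caratheodory p t p').1 dp.
pose S s := if p s == p t then dg i0 (vec2 (p t) (q s))
  else (g (vec2 (p s) (q s)) - g (vec2 (p t) (q s))) / (p s - p t).
have SE s : g (vec2 (p s) (q s)) - g (vec2 (p t) (q s)) = S s * (p s - p t).
  rewrite /S; case: eqP => [->|/eqP ps]; first by rewrite !subrr mulr0.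
  by rewrite divfK// subr_eq0.
have Sxi s : exists2 xi, S s = dg i0 (vec2 xi (q s)) &
    `|xi - p t| <= `|p s - p t|.
  have dl (a : R) : is_derive a 1 (fun a => g (vec2 a (q s))) (dg i0 (vec2 a (q s))).
    have L (h : R) : vec2 (h *: 1 + a) (q s) = h *: delta_mx 0 i0 + vec2 a (q s).
      by rewrite [h *: 1]mulr1 vec2_line0.
    exact: (is_derive_comp_affine (L := fun a => vec2 a (q s)) L (d0 _)).
  have cl : continuous (fun a => g (vec2 a (q s))).
    by move=> a; have [/derivable1_diffP/differentiable_continuous] := dl a.
  rewrite /S; case: eqP => [ps|/eqP ps]; first by exists (p t) => //;
    rewrite subrr normr0.
  have [lt|lt|] := ltgtP (p s) (p t); last by move/eqP; rewrite (negbTE ps).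
  - have [c] := MVT lt (fun a _ => dl a) (continuous_subspaceT cl).
    rewrite in_itv/= => /andP[c1' c2'] E; exists c.
      rewrite -opprB E -(opprB (p t)) invrN mulrNN mulfK// subr_eq0 eq_sym//.
    by rewrite !ltr0_norm ?subr_lt0//; lra.
  - have [c] := MVT lt (fun a _ => dl a) (continuous_subspaceT cl).
    rewrite in_itv/= => /andP[c1' c2'] E; exists c.
      by rewrite E mulfK// subr_eq0.
    by rewrite !gtr0_norm ?subr_gt0//; lra.
have cp : {for t, continuous p} by have
  [/derivable1_diffP/differentiable_continuous] := dp.
have cq : {for t, continuous q} by have
  [/derivable1_diffP/differentiable_continuous] := dq.
have St : S t = dg i0 (vec2 (p t) (q t)) by rewrite /S eqxx.
have cS : {for t, continuous S}.
  have /choice[xi xiP] : forall s, exists xi, S s = dg i0 (vec2 xi (q s)) /\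
      `|xi - p t| <= `|p s - p t| by move=> s; have [xi] := Sxi s; exists xi.
  change (S @ t --> S t); rewrite St.
  rewrite (_ : S = fun s => dg i0 (vec2 (xi s) (q s))); last first.
    by apply/funext => s; have [] := xiP s.
  apply: (@cvg_comp _ _ _ (fun s => vec2 (xi s) (q s)) (dg i0) _
    (nbhs (vec2 (p t) (q t)))); last exact: c0.
  apply: vec2_cvg; last exact: cq.
  apply/cvgrPdist_le => e e0; have /cvgrPdist_le/(_ e e0) := cp.
  apply: filterS => s; rewrite ![`|p t - _|]distrC; apply: le_trans.
  by have [] := xiP s.
have dS : is_derive t 1 (fun s => g (vec2 (p s) (q s)) - g (vec2 (p t) (q s)))
    (dg i0 (vec2 (p t) (q t)) * p').
  apply/is_derive1_caratheodory; exists (fun s => S s * P s); split.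
  - by move=> s; rewrite subrr subr0 SE pE mulrA.
  - by apply: continuousM.
  - by rewrite St Pt.
have dq1 : is_derive t 1 (fun s => g (vec2 (p t) (q s)))
    (dg i1 (vec2 (p t) (q t)) * q').
  apply: (@is_derive1_comp R (fun b => g (vec2 (p t) b)) q t _ _ _ dq).
  have L (h : R) : vec2 (p t) (h *: 1 + q t) = h *: delta_mx 0 i1 + vec2 (p t) (q t).
    by rewrite [h *: 1]mulr1 vec2_line1.
  exact: (is_derive_comp_affine (L := vec2 (p t)) L (d1 _)).
have := is_deriveD dS dq1; rewrite (_ : _ + _ = fun s => g (vec2 (p s) (q s)))//.
by apply/funext => s; rewrite !fctE subrK.
Qed.

Definition rotate (t : R) x :=
  vec2 (cos t * x 0 i0 - sin t * x 0 i1) (sin t * x 0 i0 + cos t * x 0 i1).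

Lemma enorm_rotate t x : enorm (rotate t x) = enorm x.
Proof.
rewrite /enorm !big_ord_recl !big_ord0 !addr0 !vec2_0 !vec2_1; congr (Num.sqrt _).
have := cos2Dsin2 t; set c := cos t; set s := sin t; set a := x 0 _; set b := x 0 _.
move=> E; transitivity ((c ^+ 2 + s ^+ 2) * (a ^+ 2 + b ^+ 2)); first by ring.
by rewrite E mul1r.
Qed.

Lemma rotate0 x : rotate 0 x = x.
Proof. by rewrite /rotate cos0 sin0 !mul1r !mul0r subr0 add0r vec2E. Qed.

Lemma rotateD2pi t x : rotate (t + pi *+ 2) x = rotate t x.
Proof. by rewrite /rotate sinD2pi cosD2pi. Qed.

Lemma cvg_rotate (t : R) x :
  (fun tx : R * 'rV[R]_2 => rotate tx.1 tx.2) @ (t, x) --> rotate t x.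
Proof.
have c1 : (fun tx : R * 'rV[R]_2 => cos tx.1) @ (t, x) --> cos t.
  by apply: cvg_comp; [exact: cvg_fst|exact: continuous_cos].
have c2 : (fun tx : R * 'rV[R]_2 => sin tx.1) @ (t, x) --> sin t.
  by apply: cvg_comp; [exact: cvg_fst|exact: continuous_sin].
have cx i : (fun tx : R * 'rV[R]_2 => tx.2 0 i) @ (t, x) --> x 0 i.
  by apply: (@cvg_comp _ _ _ snd (fun x => x 0 i));
    [exact: cvg_snd|exact: coord_continuous].
apply: vec2_cvg.
  by apply: cvgB; apply: cvgM.
by apply: cvgD; apply: cvgM.
Qed.

Lemma is_derive_rotate g dg x (t : R) : C1 g dg ->
  is_derive t 1 (fun t => g (rotate t x))
   (dg i1 (rotate t x) * rotate t x 0 i0 - dg i0 (rotate t x) * rotate t x 0 i1).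
Proof.
move=> gC.
have dc (a b : R) (f h : R -> R) f' h' : is_derive t 1 f f' -> is_derive t 1 h h' ->
    is_derive t 1 (fun t => f t * a + h t * b) (f' * a + h' * b).
  move=> df dh; have dfa := is_deriveM df (is_derive_cst a t 1).
  have dhb := is_deriveM dh (is_derive_cst b t 1).
  apply: (is_derive_eq (is_deriveD dfa dhb)).
  by rewrite /GRing.scale/= !mulr0 !add0r mulrC [b * _]mulrC.
have dP := dc (x 0 i0) (- x 0 i1) _ _ _ _ (is_derive_cos t) (is_derive_sin t).
have dQ := dc (x 0 i0) (x 0 i1) _ _ _ _ (is_derive_sin t) (is_derive_cos t).
have := is_derive_curve gC dP dQ.
have rE s : vec2 (cos s * x 0 i0 + sin s * - x 0 i1) (sin s * x 0 i0 + cos s *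
  x 0 i1) = rotate s x.
  by rewrite mulrN.
rewrite (_ : (fun s => g (vec2 _ _)) = fun s => g (rotate s x)); last first.
  by apply/funext => s; rewrite rE.
move=> /is_derive_eq; apply; rewrite rE [rotate t x 0 i0]vec2_0 [rotate t x 0 i1]vec2_1.
ring.
Qed.

End plane.

Section rotation_integral.
Context {R : realType}.
Local Notation mu := (@lebesgue_measure R).
Local Notation i0 := (ord0 : 'I_2).
Local Notation i1 := (lift ord0 ord0 : 'I_2).
Implicit Types (x : 'rV[R]_2) (g : 'rV[R]_2 -> R) (k : R -> R).

(** By compactness of the segment, continuity at the points $(t, x)$ is uniform
in $t$. *)
Lemma continuous_Rintegral_param (T : topologicalType) (h : R -> T -> R)
    (a b : R) (x : T) : a <= b ->
  (forall t, a <= t <= b -> (fun ty : R * T => h ty.1 ty.2) @ (t, x) --> h t x) ->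
  (forall y, continuous (h ^~ y)) ->
  {for x, continuous (fun y => \int[mu]_(t in `[a, b]) h t y)}.
Proof.
move=> ab ch cy; apply/cvgrPdist_le => e e0.
have ba : 0 < b - a + 1 by rewrite ltr_wpDl// subr_ge0.
pose e' := e / (b - a + 1); have e'0 : 0 < e' by rewrite divr_gt0.
have /compact_near_coveringP K := @segment_compact R a b.
have int y := @integrable_continuous_segment R (h ^~ y) a b (cy y).
have : \forall y \near x, forall t, `[a, b]%classic t -> `|h t x - h t y| <= e'.
  apply: (K _ (nbhs x) (fun y t => `|h t x - h t y| <= e')) => t.
  rewrite /= in_itv/= => tab; have /cvgrPdist_lt/(_ (e' / 2)) := ch t tab.
  have e20 : 0 < e' / 2 by rewrite divr_gt0.
  move=> /(_ e20)[[A B] /= [tA xB] AB]; exists (A, B) => //= -[s y] /= [sA yB].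
  have /ltW H1 := AB (s, x) (conj sA (nbhs_singleton xB)).
  have /ltW H2 := AB (s, y) (conj sA yB).
  rewrite -(subrK (h t x) (h s x)) -addrA (le_trans (ler_normD _ _))//.
  by rewrite [leRHS]splitr lerD// distrC.
apply: filterS => y Hy.
rewrite -RintegralB; [|by []|exact: int|exact: int].
have cB : continuous (fun t => h t x - h t y).
  by move=> t; apply: continuousB; exact: cy.
rewrite (le_trans (le_normr_Rintegral _ (integrable_continuous_segment _ _ cB)))//.
have -> : e = e' * (b - a + 1) by rewrite divfK// gt_eqF.
have cD : continuous (fun t => `|h t x - h t y|).
  move=> t; apply: (@continuous_comp _ _ _ (fun t => h t x - h t y) Num.norm).
    exact: cB.
  exact: norm_continuous.
have le : \int[mu]_(t in `[a, b]) `|h t x - h t y| <= \int[mu]_(t in `[a, b]) e'.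
  apply: (@le_Rintegral _ _ _ mu) => //.
    exact: integrable_continuous_segment _ _ cD.
  exact: (integrable_continuous_segment _ _ (@cst_continuous _ _ e')).
apply: (le_trans le); rewrite Rintegral_cst//= lebesgue_measure_itv/= lte_fin.
rewrite ler_wpM2l ?(ltW e'0)//; case: ltP => _ /=; lra.
Qed.

Definition rotation_integral k g x : R :=
  \int[mu]_(t in `[0, pi *+ 2]) (k t * g (rotate t x)).

Lemma continuous_rotate_fun k g x : continuous k -> continuous g ->
  continuous (fun t => k t * g (rotate t x)).
Proof.
move=> ck cg t; apply: continuousM; first exact: ck.
apply: (continuous_comp (f := fun t => rotate t x)); last exact: cg.
have cM (f : R -> R) (c : R) : continuous f -> f s * c @[s --> t] --> f t * c.
  by move=> cf; apply: cvgM; [exact: cf|exact: cvg_cst].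
have [cc cs] := (@continuous_cos R, @continuous_sin R).
by apply: vec2_cvg; [apply: cvgB|apply: cvgD]; exact: cM.
Qed.

Lemma rotation_integral_continuous k g : continuous k -> continuous g ->
  continuous (rotation_integral k g).
Proof.
move=> ck cg x; apply: (@continuous_Rintegral_param _ (fun t y => k t * g (rotate t y))).
- by rewrite mulrn_wge0// pi_ge0.
- move=> t _; apply: cvgM.
    by apply: (cvg_comp _ _ cvg_fst); exact: ck.
  by apply: (cvg_comp _ _ (cvg_rotate (t := t) (x := x))); exact: cg.
- by move=> y; exact: continuous_rotate_fun.
Qed.

Lemma continuous_segment_bounded k (a b : R) : continuous k ->
  exists M, forall t, a <= t <= b -> `|k t| <= M.
Proof.
move=> ck.
have [M0 [_ HM]] : bounded_set (k @` `[a, b]).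
  apply: compact_bounded; apply: continuous_compact; last exact: segment_compact.
  exact: continuous_subspaceT.
exists (M0 + 1) => t tab; apply: (HM (M0 + 1)); first by rewrite ltrDl.
by exists t => //=; rewrite in_itv.
Qed.

Lemma rotate_line (t h : R) x v :
  rotate t (h *: v + x) = vec2 (h * rotate t v 0 i0 + rotate t x 0 i0)
                               (h * rotate t v 0 i1 + rotate t x 0 i1).
Proof. rewrite {1}/rotate !vec2_0 !vec2_1 !mxE; congr vec2; ring. Qed.

Lemma continuous_rotate_coord v i : continuous (fun t : R => rotate t v 0 i).
Proof.
rewrite (_ : (fun t => _) = (fun t => 1 * rotate t v 0 i)).
  apply: (@continuous_rotate_fun (fun=> 1) (fun x => x 0 i)).
    exact: cst_continuous.
  exact: coord_continuous.
by apply/funext => t; rewrite mul1r.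
Qed.

Lemma C1_rotation_integral B k g dg : continuous k -> C1 g dg ->
  (forall i, continuous_in_cube B (dg i)) ->
  C1 (rotation_integral k g) (fun i x =>
    rotation_integral (fun t => k t * rotate t (delta_mx 0 i) 0 i0) (dg i0) x +
    rotation_integral (fun t => k t * rotate t (delta_mx 0 i) 0 i1) (dg i1) x).
Proof.
move=> ck gC dgB; have [cg dgC] := gC.
split=> [|i]; first exact: rotation_integral_continuous.
have pi20 : 0 <= pi *+ 2 :> R by rewrite mulrn_wge0// pi_ge0.
have ckr j : continuous (fun t => k t * rotate t (delta_mx 0 i) 0 j).
  by move=> t; apply: continuousM; [exact: ck|exact: continuous_rotate_coord].
have cr j : continuous (rotation_integral
    (fun t => k t * rotate t (delta_mx 0 i) 0 j) (dg j)).
  by apply: rotation_integral_continuous => //; have [] := dgB j.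
split=> [x|x]; last by apply: continuousD; exact: cr.
pose e := delta_mx 0 i : 'rV[R]_2.
pose f (s t : R) := k t * g (rotate t (s *: e + x)).
pose df (s t : R) :=
  k t * rotate t e 0 i0 * dg i0 (rotate t (s *: e + x)) +
  k t * rotate t e 0 i1 * dg i1 (rotate t (s *: e + x)).
have dfE (s t : R) : is_derive s 1 (f ^~ t) (df s t).
  have dl (c d : R) : is_derive s 1 (fun s => s * c + d) c.
    apply: (is_derive_eq (is_deriveD (is_deriveM (is_derive_id s 1)
      (is_derive_cst c s 1)) (is_derive_cst d s 1))).
    by rewrite /GRing.scale/= mulr0 add0r addr0 mulr1.
  have := is_derive_curve gC (dl (rotate t e 0 i0) (rotate t x 0 i0))
    (dl (rotate t e 0 i1) (rotate t x 0 i1)).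
  rewrite (_ : (fun s => g (vec2 _ _)) = fun s => g (rotate t (s *: e + x))); last first.
    by apply/funext => y; rewrite rotate_line.
  rewrite -rotate_line => dg1; apply: (is_derive_eq (is_deriveZ (k t) dg1)).
  by rewrite /df /GRing.scale/=; ring.
have [M0 HM0] := bounded_continuous_in_cube (dgB i0).
have [M1 HM1] := bounded_continuous_in_cube (dgB i1).
have [K0 HK0] := continuous_segment_bounded 0 (pi *+ 2) (ckr i0).
have [K1 HK1] := continuous_segment_bounded 0 (pi *+ 2) (ckr i1).
have K00 : 0 <= K0 by apply: le_trans (HK0 0 _); rewrite ?lexx.
have K10 : 0 <= K1 by apply: le_trans (HK1 0 _); rewrite ?lexx.
have M00 : 0 <= M0 by apply: le_trans (HM0 0).
have M10 : 0 <= M1 by apply: le_trans (HM1 0).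
have I0 : `](-1 : R), 1[%classic 0 by rewrite /= in_itv/= ltrN10 ltr01.
have intf s : mu.-integrable `[0, pi *+ 2] (EFin \o f s).
  by apply: integrable_continuous_segment; exact: continuous_rotate_fun.
have mI : measurable (`[0, pi *+ 2]%classic : set (measurableTypeR R)) by
  exact: measurable_itv.
have derf (s t : R) : `](-1 : R), 1[%classic s -> `[0, pi *+ 2]%classic t ->
  derivable (f ^~ t) s 1 by case: (dfE s t).
have d1f s t : partial1of2 f s t = df s t.
  by rewrite partial1of2E; have [_ ->] := dfE s t.
have ub (s t : R) : `](-1 : R), 1[%classic s -> `[0, pi *+ 2]%classic t ->
    `|partial1of2 f s t| <= K0 * M0 + K1 * M1.
  rewrite /= => _; rewrite in_itv/= => tp; rewrite d1f /df.
  rewrite (le_trans (ler_normD _ _))// !(normrM _ (dg _ _)) lerD//.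
    by rewrite ler_pM// HK0.
  by rewrite ler_pM// HK1.
have intG : mu.-integrable `[0, pi *+ 2] (EFin \o (fun=> K0 * M0 + K1 * M1)).
  exact: (integrable_continuous_segment _ _ (@cst_continuous _ _ _)).
have G0 (t : R) : 0 <= K0 * M0 + K1 * M1 by rewrite addr_ge0// mulr_ge0.
have D := @derivable_under_integral R _ _ mu f _ mI 0 (-1) 1 I0
  (fun s _ => intf s) derf _ G0 intG ub.
have E := @differentiation_under_integral R _ _ mu f _ mI 0 (-1) 1 I0
  (fun s _ => intf s) derf _ G0 intG ub.
pose L (s : R) := s *: e + x.
have L0 : L 0 = x by rewrite /L scale0r add0r.
have LE (h : R) : L (h *: 1 + 0) = h *: e + L 0.
  by rewrite L0 /L addr0 [h *: 1]mulr1.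
have [cE DE] := derive_comp_affine (rotation_integral k g) LE.
split; first by move/cE : D; rewrite L0.
rewrite L0 in DE; rewrite -DE -derive1E; apply: (etrans E).
rewrite -RintegralD//.
- apply: eq_Rintegral => t _; rewrite -[LHS]/(partial1of2 f 0 t) d1f /df.
  by rewrite scale0r add0r.
- apply: integrable_continuous_segment.
  by apply: continuous_rotate_fun; [exact: ckr|have [] := dgB i0].
- apply: integrable_continuous_segment.
  by apply: continuous_rotate_fun; [exact: ckr|have [] := dgB i1].
Qed.

End rotation_integral.

(** * The gap on circles *)

Section plane_gap.
Context {R : realType} (al be : R).
Hypothesis al0 : 0 < al.
Local Notation V := 'rV[R]_2.
Local Notation mu := (@lebesgue_measure R).
Local Notation annulus := (@annulus R 2 al be).
Local Notation i0 := (ord0 : 'I_2).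
Local Notation i1 := (lift ord0 ord0 : 'I_2).
Variables (u : V -> R) (d : 'I_2 -> V -> R) (dd : 'I_2 -> 'I_2 -> V -> R)
  (ddd : 'I_2 -> 'I_2 -> 'I_2 -> V -> R).
Hypothesis uC : C1 u d.
Hypothesis dC : forall j, C1 (d j) (fun i => dd i j).
Hypothesis ddC : forall j k, C1 (dd j k) (fun i => ddd i j k).
Hypothesis ddS : forall i j, dd i j = dd j i.
Hypothesis d0 : forall i x, ~ annulus x -> d i x = 0.
Hypothesis dd0 : forall i j x, ~ annulus x -> dd i j x = 0.

(** With $\theta$ the polar angle, the next functions are $\partial_\theta u$, its
gradient and $\partial_\theta^2 u$. *)
Definition ang (x : V) := x 0 i0 * d i1 x - x 0 i1 * d i0 x.

Definition grad_ang i (x : V) :=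
  ((i0 == i)%:R * d i1 x + x 0 i0 * dd i i1 x) -
  ((i1 == i)%:R * d i0 x + x 0 i1 * dd i i0 x).

Definition ang2 (x : V) := x 0 i0 * grad_ang i1 x - x 0 i1 * grad_ang i0 x.

Definition ang_defect (x : V) := ang2 x * ang2 x - ang x * ang x.

Let ang_C1 : C1 ang grad_ang.
Proof. exact: C1B (C1M (C1_coord i0) (dC i1)) (C1M (C1_coord i1) (dC i0)). Qed.

Let grad_ang_C1 i : exists dg, C1 (grad_ang i) dg.
Proof.
eexists; exact: C1B (C1D (C1M (C1_cst _) (dC i1)) (C1M (C1_coord i0) (ddC i i1)))
  (C1D (C1M (C1_cst _) (dC i0)) (C1M (C1_coord i1) (ddC i i0))).
Qed.

Let ang2_C1 : exists dg, C1 ang2 dg.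
Proof.
have [g0 C0] := grad_ang_C1 i0; have [g1 C1'] := grad_ang_C1 i1.
by eexists; exact: C1B (C1M (C1_coord i0) C1') (C1M (C1_coord i1) C0).
Qed.

Let ang_defect_C1 : exists dg, C1 ang_defect dg.
Proof.
have [g2 C2] := ang2_C1.
by eexists; exact: C1B (C1M C2 C2) (C1M ang_C1 ang_C1).
Qed.

Let ang_defect0 x : ~ annulus x -> ang_defect x = 0.
Proof.
move=> xA; rewrite /ang_defect /ang2 /grad_ang /ang !d0// !dd0//.
by rewrite !(mulr0, addr0, subr0).
Qed.

Lemma wirtinger_circle x :
  0 <= \int[mu]_(t in `[0, pi *+ 2]) ang_defect (rotate t x).
Proof.
have [g2 C2] := ang2_C1.
have dU (t : R) : is_derive t 1 (fun t => u (rotate t x)) (ang (rotate t x)).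
  apply: (is_derive_eq (is_derive_rotate x t uC)).
  by rewrite /ang; ring.
have df (t : R) : is_derive t 1 (fun t => ang (rotate t x)) (ang2 (rotate t x)).
  apply: (is_derive_eq (is_derive_rotate x t ang_C1)).
  by rewrite /ang2; ring.
have cf' : continuous (fun t => ang2 (rotate t x)).
  move=> t; have [/derivable1_diffP/differentiable_continuous] := is_derive_rotate x t C2.
  exact.
have := wirtinger dU df cf' (fun t => congr1 u (rotateD2pi t x)).
by congr (_ <= _); apply: eq_Rintegral => t _; rewrite /ang_defect !expr2.
Qed.

(** In the plane $r^2 A$ has the single entry $\partial_\theta^2 u$. *)
Lemma sphere_gap_plane (v : R -> R) x : annulus x ->
  sphere_gap d dd v x = v (enorm x) / enorm x ^+ 4 * ang_defect x.
Proof.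
move=> xA; have r0 := lt0r_neq0 (annulus_gt0 al0 xA).
have E : enorm x ^+ 2 = x 0 i0 ^+ 2 + x 0 i1 ^+ 2.
  by rewrite enorm_sqr !big_ord_recl big_ord0 addr0.
have E4 : enorm x ^+ 4 = (x 0 i0 ^+ 2 + x 0 i1 ^+ 2) ^+ 2.
  by rewrite (exprM _ 2 2) E.
have s0 : x 0 i0 ^+ 2 + x 0 i1 ^+ 2 != 0 by rewrite -E expf_neq0.
rewrite /sphere_gap -mulrA; congr (_ * _).
rewrite /tangential_hess /tangential_grad E4 E.
rewrite /hess_sqr /rad_dd_sqr /rad_rad /rad_dd /rad_d /lap /grad_sqr.
rewrite /ang_defect /ang2 /grad_ang /ang.
rewrite !big_ord_recl !big_ord0 /= !addr0 (ddS i1 i0).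
move: (x 0 i0) (x 0 i1) (d i0 x) (d i1 x) (dd i0 i0 x) (dd i0 i1 x) (dd i1 i1 x) s0.
move=> a b d_0 d_1 h00 h01 h11 s0.
by field.
Qed.

Section gap.
Variables (v v1 : R -> R).
Hypothesis v_ge0 : forall r, al <= r <= be -> 0 <= v r.
Hypothesis dv : forall r, al <= r <= be -> is_derive r 1 v (v1 r).
Hypothesis cv1 : forall r, al <= r <= be -> {for r, continuous v1}.
Hypothesis gapA : in_annulus al be (sphere_gap d dd v).

(** Let $\Psi = (\partial_\theta^2 u)^2 - (\partial_\theta u)^2$ and
$Z(x) = \int_0^{2 \pi} (t - 2 \pi) \Psi(R_t x)\, dt$, with $R_t$ the rotation by
$t$. Integration by parts in $t$ gives
$\partial_\theta Z = 2 \pi \Psi - \int_0^{2 \pi} \Psi(R_t x)\, dt$. The last integral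
is nonnegative by Wirtinger, and $\partial_\theta Z$, which is the divergence of
$Z (-x_2, x_1)$, integrates to 0 against any radial weight. *)
Lemma sphere_gap_dim2 : integral_pos al be (sphere_gap d dd v).
Proof.
have [dP PC] := ang_defect_C1.
have dPB i : continuous_in_cube be (dP i).
  exact: in_annulus_cube (in_annulus_C1_derive i PC ang_defect0).
pose k (t : R) := t - pi *+ 2.
have ck : continuous k.
  by move=> t; apply: cvgB; [exact: cvg_id|exact: cvg_cst].
have ZC := C1_rotation_integral ck PC dPB.
set Z := rotation_integral k ang_defect in ZC.
have Z0 x : ~ annulus x -> Z x = 0.
  move=> xA; rewrite /Z /rotation_integral (@eq_Rintegral _ _ _ _ _ (cst 0)).
    by rewrite Rintegral_cst// mul0r.
  move=> t _ /=; rewrite ang_defect0 ?mulr0//.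
  by rewrite /annulus /= enorm_rotate.
pose Y (i : 'I_2) : V -> R :=
  if i == i0 then fun x : V => - (x 0 i1 * Z x) else fun x : V => x 0 i0 * Z x.
pose dZ i (x : V) :=
  rotation_integral (fun t => k t * rotate t (delta_mx 0 i) 0 i0) (dP i0) x +
  rotation_integral (fun t => k t * rotate t (delta_mx 0 i) 0 i1) (dP i1) x.
pose dY (i j : 'I_2) : V -> R :=
  if i == i0 then fun x : V => - ((i1 == j)%:R * Z x + x 0 i1 * dZ j x)
  else fun x : V => (i0 == j)%:R * Z x + x 0 i0 * dZ j x.
have YC i : C1 (Y i) (dY i).
  rewrite /Y /dY; case: eqP => _; first exact: C1N (C1M (C1_coord i1) ZC).
  exact: C1M (C1_coord i0) ZC.
have Y0 i (x : V) : ~ annulus x -> Y i x = 0.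
  by move=> xA; rewrite /Y; case: eqP; rewrite Z0// mulr0 ?oppr0.
have rp r : al <= r <= be -> 0 < r.
  by move=> /andP[ar _]; exact: lt_le_trans ar.
have da r (rA : al <= r <= be) := is_derive_divX 4 (rp r rA) (dv rA).
have ca r : al <= r <= be ->
    {for r, continuous (fun r => v1 r / r ^+ 4 - 4%:R * v r / r ^+ 5)}.
  move=> rA; have [/derivable1_diffP/differentiable_continuous cv _] := dv rA.
  apply: continuousB; apply: continuous_divX; rewrite ?rp//; first exact: cv1.
  by apply: continuousM => //; exact: cst_continuous.
have := divergence_radial al0 da ca YC Y0.
have -> : (fun x : V => (v1 (enorm x) / enorm x ^+ 4 - 4%:R * v (enorm x) /
  enorm x ^+ 5) /
     enorm x * (\sum_i x 0 i * Y i x) + v (enorm x) / enorm x ^+ 4 * (\sum_i dY i i x)) =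
   (fun x : V => v (enorm x) / enorm x ^+ 4 * (x 0 i0 * dZ i1 x - x 0 i1 * dZ i0 x)).
  have e1 : (i1 == i0) = false by []. have e2 : (i0 == i1) = false by [].
  apply/funext => x; rewrite !big_ord_recl !big_ord0 !addr0 /Y /dY.
  by rewrite !(eqxx, e1, e2)/= !mul0r; ring.
have DZ (x : V) : x 0 i0 * dZ i1 x - x 0 i1 * dZ i0 x =
    pi *+ 2 * ang_defect x - \int[mu]_(t in `[0, pi *+ 2]) ang_defect (rotate t x).
  pose psi t := ang_defect (rotate t x).
  pose psi' t := dP i1 (rotate t x) * rotate t x 0 i0 - dP i0 (rotate t x) *
    rotate t x 0 i1.
  have dpsi (t : R) : is_derive t 1 psi (psi' t) := is_derive_rotate x t PC.
  have ck1 i j : continuous (fun t => k t * rotate t (delta_mx 0 i) 0 j).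
    by move=> t; apply: continuousM; [exact: ck|exact: continuous_rotate_coord].
  have cG i j l : continuous (fun t => k t * rotate t (delta_mx 0 i) 0 j * dP l
    (rotate t x)).
    by apply: continuous_rotate_fun; [exact: ck1|exact: (PC.2 l).2].
  have cpsi : continuous psi.
    by move=> t; have [/derivable1_diffP/differentiable_continuous] := dpsi t.
  have cpsi' : continuous psi'.
    have cr l j : continuous (fun t => rotate t x 0 j * dP l (rotate t x)).
      by apply: continuous_rotate_fun; [exact: continuous_rotate_coord|exact: (PC.2 l).2].
    move=> t; rewrite (_ : psi' = fun t => rotate t x 0 i0 * dP i1 (rotate t x) -
        rotate t x 0 i1 * dP i0 (rotate t x)).
      by apply: cvgB; exact: cr.
    by apply/funext => s; rewrite /psi' mulrC [dP i0 _ * _]mulrC.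
  have ckpsi' : continuous (fun t => k t * psi' t).
    by move=> t; apply: continuousM; [exact: ck|exact: cpsi'].
  have int_kpsi' : x 0 i0 * dZ i1 x - x 0 i1 * dZ i0 x =
      \int[mu]_(t in `[0, pi *+ 2]) (k t * psi' t).
    have E i : dZ i x = \int[mu]_(t in `[0, pi *+ 2])
        (1 * (k t * rotate t (delta_mx 0 i) 0 i0 * dP i0 (rotate t x)) +
         1 * (k t * rotate t (delta_mx 0 i) 0 i1 * dP i1 (rotate t x))).
      by rewrite Rintegral_lin// !mul1r.
    have cE i : continuous (fun t =>
         1 * (k t * rotate t (delta_mx 0 i) 0 i0 * dP i0 (rotate t x)) +
         1 * (k t * rotate t (delta_mx 0 i) 0 i1 * dP i1 (rotate t x))).
      by move=> t; apply: cvgD; apply: cvgM;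
        [exact: cvg_cst|exact: cG|exact: cvg_cst|exact: cG].
    rewrite !E -mulNr -Rintegral_lin//; apply: eq_Rintegral => t _.
    by rewrite /psi' /rotate !vec2_0 !vec2_1 !mxE/=; ring.
  rewrite int_kpsi'.
  have dkpsi (t : R) : is_derive t 1 (fun t => k t * psi t) (psi t + k t * psi' t).
    have dk : is_derive t 1 k 1.
      apply: (is_derive_eq (is_deriveB (is_derive_id t 1) (is_derive_cst (pi *+ 2) t 1))).
      by rewrite subr0.
    apply: (is_derive_eq (is_deriveM dk (dpsi t))).
    by rewrite /GRing.scale/=; ring.
  have F : \int[mu]_(t in `[0, pi *+ 2]) (1 * psi t + 1 * (k t * psi' t)) =
      k (pi *+ 2) * psi (pi *+ 2) - k 0 * psi 0.
    rewrite /Rintegral (@continuous_FTC2 _ _ (fun t => k t * psi t) 0 (pi *+ 2)).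
    - by [].
    - by rewrite mulrn_wgt0// pi_gt0.
    - by apply: continuous_subspaceT => t; apply: cvgD; apply: cvgM;
        [exact: cvg_cst|exact: cpsi|exact: cvg_cst|exact: ckpsi'].
    - have cc (t : R) : {for t, continuous (fun t => k t * psi t)}.
        by have [/derivable1_diffP/differentiable_continuous] := dkpsi t.
      split; [|apply: cvg_at_right_filter; exact: cc|apply: cvg_at_left_filter;
        exact: cc].
      by move=> t _; have [] := dkpsi t.
    - by move=> t _; rewrite derive1E !mul1r; have [] := dkpsi t.
  have := F; rewrite Rintegral_lin// !mul1r => /(canRL (addKr _)) ->.
  by rewrite /k subrr mul0r sub0r /psi rotate0 sub0r mulNr opprK addrC.
move=> /integral_nullW/(integral_posZ (c := (pi *+ 2)^-1)).
have pi2 : 0 < pi *+ 2 :> R by rewrite mulrn_wgt0// pi_gt0.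
rewrite invr_ge0 (ltW pi2) => /(_ isT) H; apply: (integral_pos_le H gapA) => x xA.
rewrite DZ sphere_gap_plane// ler_pdivrMl//.
rewrite mulrCA ler_wpM2l//; last by rewrite gerBl wirtinger_circle.
by rewrite divr_ge0 ?exprn_ge0 ?enorm_ge0// v_ge0.
Qed.

End gap.
End plane_gap.

(** * Test functions and Bessel pairs *)

Section smooth_functions.
Context {R : realType} {N : nat}.
Implicit Types (u : 'rV[R]_N -> R).

Lemma smooth_C1 u s : smooth u ->
  C1 (foldr partial u s) (fun i => foldr partial u (i :: s)).
Proof.
move=> su; have [cu du] := su s; split=> // i; split; last by have [] := su (i :: s).
by move=> x; apply: derivableP; exact: du.
Qed.

Lemma smooth_partialC u s (i j : 'I_N) : smooth u ->
  partial i (partial j (foldr partial u s)) =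
  partial j (partial i (foldr partial u s)).
Proof.
move=> su; apply/funext => x; apply: partialC => [y|y|y|y||].
- exact: (su s).2.
- exact: (su s).2.
- exact: (su (i :: s)).2.
- exact: (su (j :: s)).2.
- exact: (su [:: j, i & s]).1.
- exact: (su [:: i, j & s]).1.
Qed.

Lemma test_function_annulus (Rad : \bar R) u : (0 < Rad)%E ->
  test_function (eball Rad `\` [set 0]) u ->
  exists al be, [/\ 0 < al, (be%:E < Rad)%E &
    forall x, ~ annulus al be x -> u x = 0].
Proof.
move=> Rad0 [_ cK KD]; set K := closure _ in cK KD.
have uK x : ~ K x -> u x = 0.
  by move=> xK; apply/eqP/negP => /negP ux; apply: xK; exact: subset_closure.
have [K0|/set0P K0] := eqVneq K set0.
  exists 1, 0; split => // x _; apply: uK; by rewrite K0.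
have ce := continuous_subspaceT (@enorm_continuous R N).
have [c cK' cmax] := compact_EVT_max K0 cK (ce K).
have [b bK bmin] := compact_EVT_min K0 cK (ce K).
exists (enorm b), (enorm c); split.
- rewrite lt_neqAle enorm_ge0 andbT eq_sym; apply/eqP => b0.
  have [_] := KD _ (set_mem bK); apply; rewrite /=.
  apply/rowP => i; rewrite mxE; apply/eqP; rewrite -normr_le0 -b0.
  exact: ler_coord_enorm.
- by have [] := KD _ (set_mem cK').
- move=> x xA; apply: uK => /mem_set xK; apply: xA.
  by rewrite /annulus /= bmin// cmax.
Qed.

End smooth_functions.

Section bessel_riccati.
Context {R : realType}.
Implicit Types (V W : R -> R).

(** The function is $q = V \varphi'/\varphi$, written as the quotient of the flux by
$r^{N+1} \varphi$ because only the flux is known to be differentiable. Its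
derivative contains $- V (\varphi'/\varphi)^2$, and
$q^2/(V + \varepsilon) \le V (\varphi'/\varphi)^2$. *)
Lemma bessel_pair_riccati (N : nat) (Rad : \bar R) V W :
  (forall r, itv0 Rad r -> 0 <= V r) ->
  bessel_pair (N + 2) Rad V (fun r => W r + N%:R * (derive1 V r / r)) ->
  exists q : R -> R, forall r, itv0 Rad r -> derivable q r 1 /\
    forall e, 0 < e -> 'D_1 q r <= - (N%:R + 1) * (q r / r) - W r
      - N%:R * (derive1 V r / r) - q r ^+ 2 / (V r + e).
Proof.
move=> V0 [_ [phi H]].
pose flux s := s ^+ N.+1 * V s * derive1 phi s.
pose den s := s ^+ N.+1 * phi s.
exists (fun s => flux s / den s) => r rI.
have r0 : 0 < r by case: rI.
have [p0 dphi dflux fluxE] := H r rI.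
rewrite addn2 /= -/flux in dflux fluxE.
have den0 : den r != 0 by rewrite mulf_neq0 ?expf_neq0 ?lt0r_neq0.
have dX : is_derive r 1 (fun s : R => s ^+ N.+1) (N.+1%:R * r ^+ N).
  by split; [exact: exprn_derivable|rewrite exp_derive [_ *: 1]mulr1].
have dp : is_derive r 1 phi (derive1 phi r).
  by split; [exact: dphi|rewrite derive1E].
have dden : is_derive r 1 den (r ^+ N.+1 * derive1 phi r + phi r * (N.+1%:R * r ^+ N)).
  exact: is_deriveM dX dp.
have df : is_derive r 1 flux (derive1 flux r).
  by split; [exact: dflux|rewrite derive1E].
have dV : is_derive r 1 (fun s : R => (den s)^-1) _ := is_deriveV den0 dden.
have [dq qE] := is_deriveM df dV.
split; first exact: dq.
move=> e e0; rewrite qE.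
have Ve : 0 < V r + e by rewrite ltr_wpDl ?V0.
have -> : derive1 flux r = - (r ^+ N.+1 * (W r + N%:R * (derive1 V r / r)) * phi r).
  by apply/eqP; rewrite -addr_eq0; apply/eqP.
rewrite /flux /den /GRing.scale/=.
set P := derive1 phi r; set V' := derive1 V r.
rewrite -subr_ge0.
have rN : r ^+ N != 0 by rewrite expf_neq0 ?lt0r_neq0.
suff : 0 <= V r * (P / phi r) ^+ 2 * (e / (V r + e)).
  congr (_ <= _); rewrite !exprS -natr1; field.
  by rewrite rN !lt0r_neq0.
apply: mulr_ge0 (divr_ge0 (ltW e0) (ltW Ve)).
by rewrite mulr_ge0 ?sqr_ge0 ?V0.
Qed.

End bessel_riccati.

Lemma integral_Rn_annulus (R : realType) (N : nat) (Rad : \bar R) (al be : R)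
    (f : 'rV[R]_N -> R) : (be%:E < Rad)%E -> in_annulus al be f ->
  integral_Rn (eball Rad) f = (integral_tuple f)%:E.
Proof.
move=> beR fA; rewrite -(integral_tupleE (in_annulus_cube fA)) /integral_Rn.
rewrite integral_mkcond; apply: eq_integral => t _; rewrite patchE.
case: ifPn => // /negP tR; congr EFin; apply/esym/fA.2 => /andP[_ tbe].
apply: tR; rewrite inE /= /eball /=; apply: le_lt_trans beR.
by rewrite lee_fin.
Qed.

Theorem theorem1p4 (R : realType) (N : nat) (Rad : \bar R) (V2 W2 : R -> R)
  (hN : (1 <= N)%N)
  (hRad : (0 < Rad)%E)
  (hV2 : forall r, itv0 Rad r -> 0 <= V2 r)
  (sV2 : smooth_itv0 Rad V2)
  (sW2 : smooth_itv0 Rad W2)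
  (hVW : bessel_pair (N + 2) Rad V2
           (fun r => W2 r + N%:R * (derive1 V2 r / r)))
  (hV2'' : forall r, itv0 Rad r ->
     derive1n 2 V2 r - 3%:R * (derive1 V2 r / r)
       - (N%:R - 5%:R) * (V2 r / r ^+ 2) <= 0)
  (u : 'rV[R]_N -> R)
  (hu : test_function (eball Rad `\` [set 0]) u) :
  (integral_Rn (eball Rad)
     (fun x => V2 (enorm x) * `|laplacian u x| ^+ 2)%R
   >= integral_Rn (eball Rad)
     (fun x => W2 (enorm x) * enorm (gradient u x) ^+ 2)%R)%E.
Proof.
have [al [be [al0 beR u0]]] := test_function_annulus hRad hu.
have su : smooth u by case: hu.
pose d i := partial i u.
pose dd i j := partial i (partial j u).
pose ddd i j k := partial i (partial j (partial k u)).
have uC : C1 u d := smooth_C1 [::] su.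
have dC j : C1 (d j) (fun i => dd i j) := smooth_C1 [:: j] su.
have ddC j k : C1 (dd j k) (fun i => ddd i j k) := smooth_C1 [:: j; k] su.
have ddS i j : dd i j = dd j i := smooth_partialC [::] i j su.
have dddS i j k : ddd i j k = ddd j i k := smooth_partialC [:: k] i j su.
have d0 i x : ~ annulus al be x -> d i x = 0.
  exact: (in_annulus_C1_derive i uC u0).2.
have dd0 i j x : ~ annulus al be x -> dd i j x = 0.
  exact: (in_annulus_C1_derive i (dC j) (d0 j)).2.
have rI r : al <= r <= be -> itv0 Rad r.
  move=> /andP[ar rb]; split; first exact: lt_le_trans ar.
  by apply: le_lt_trans beR; rewrite lee_fin.
have dv r : al <= r <= be -> is_derive r 1 V2 (derive1 V2 r).
  by move=> /rI/(sV2 0%N) dV; split; [exact: dV|rewrite derive1E].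
have dv1 r : al <= r <= be -> is_derive r 1 (derive1 V2) (derive1n 2 V2 r).
  by move=> /rI/(sV2 1%N) dV; split; [exact: dV|rewrite -derive1E].
have cont (f : R -> R) r : derivable f r 1 -> {for r, continuous f}.
  by move=> /derivable1_diffP/differentiable_continuous.
have cv r : al <= r <= be -> {for r, continuous V2}.
  by move=> /rI/(sV2 0%N)/cont.
have cv1 r : al <= r <= be -> {for r, continuous (derive1 V2)}.
  by move=> /rI/(sV2 1%N)/cont.
have cv2 r : al <= r <= be -> {for r, continuous (derive1n 2 V2)}.
  by move=> /rI/(sV2 2%N)/cont.
have cw r : al <= r <= be -> {for r, continuous W2}.
  by move=> /rI/(sW2 0%N)/cont.
have v0 r : al <= r <= be -> 0 <= V2 r by move=> /rI/hV2.
have [q qP] := bessel_pair_riccati hV2 hVW.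
have dq r : al <= r <= be -> derivable q r 1 by move=> /rI/qP[].
have riccati r e : al <= r <= be -> 0 < e ->
    'D_1 q r <= - (N%:R + 1) * (q r / r) - W2 r
      - N%:R * (derive1 V2 r / r) - q r ^+ 2 / (V2 r + e).
  by move=> /rI/qP[_]; exact.
have gap : integral_pos al be (sphere_gap d dd V2).
  have [N3|] := ltnP 2 N.
    exact: (sphere_gap_dim_ge3 al0 dC ddC ddS dddS d0 dd0 v0 dv dv1 cv2 N3).
  rewrite leq_eqVlt => /orP[/eqP N2|]; last first.
    rewrite ltnS leq_eqVlt ltnNge hN orbF => /eqP N1.
    exact: (sphere_gap_dim1 al0 dC ddC d0 dd0 dv N1).
  subst N; apply: (sphere_gap_dim2 al0 uC dC ddC ddS d0 dd0 v0 dv cv1).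
  exact: (in_annulus_sphere_gap al0 dC ddC d0 dd0 dv).
have hv r : al <= r <= be -> derive1n 2 V2 r - 3%:R * (derive1 V2 r / r)
    - (N%:R - 5%:R) * (V2 r / r ^+ 2) <= 0 by move=> /rI/hV2''.
have [_ pos] := integral_rellich_bessel al0 dC ddC ddS dddS d0 dd0 v0 dv dv1 cv2
  cw dq riccati hv gap.
have LA : in_annulus al be (fun x => V2 (enorm x) * (lap dd x * lap dd x)).
  apply: in_annulus_radialM => //; apply: in_annulusM; exact: in_annulus_lap ddC dd0.
have GA : in_annulus al be (fun x => W2 (enorm x) * grad_sqr d x).
  by apply: in_annulus_radialM => //; exact: in_annulus_grad_sqr dC d0.
have -> : (fun x => V2 (enorm x) * `|laplacian u x| ^+ 2) =
    (fun x => V2 (enorm x) * (lap dd x * lap dd x)).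
  by apply/funext => x; rewrite real_normK ?num_real// expr2.
have -> : (fun x => W2 (enorm x) * enorm (gradient u x) ^+ 2) =
    (fun x => W2 (enorm x) * grad_sqr d x).
  apply/funext => x; rewrite enorm_sqr; congr (_ * _).
  by apply: eq_bigr => i _; rewrite mxE expr2.
rewrite (integral_Rn_annulus beR LA) (integral_Rn_annulus beR GA) lee_fin -subr_ge0.
move: pos; rewrite (integral_tupleD LA (in_annulusN GA)).
rewrite (_ : (fun x => - _) = (fun x => - 1 * (W2 (enorm x) * grad_sqr d x))).
  by rewrite (integral_tupleZ _ GA) mulN1r.
by apply/funext => x; rewrite mulN1r.
Qed.
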